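(* Let $\alpha>0$, $d_1,d_2,d_3\in\mathbb{R}$, $0<\sigma^2<2\alpha$, and let $Q\neq O$ be an equilibrium of the deterministic system (D) in $\mathbb{R}^3_+$. Let $f_Q$ be the density function corresponding to the ergodic stationary measure $\mu_Q$ of the stochastic system (S). Then $\{f_Q\}$ (as a family in $\sigma$) undergoes a P-bifurcation at $\sigma^2=\alpha$.
   Context: $\mathbb{R}^3_+=[0,\infty)^3$, $O=(0,0,0)$; $(W_t)_{t\in\mathbb{R}}$ is a two-sided Brownian motion. System (S) is the Itô system $$\begin{aligned}dx_1&=x_1(\alpha-\alpha x_1^2-(2\alpha+d_1)x_2^2+d_2x_3^2)\,dt+\sigma x_1\,dW_t,\\ dx_2&=x_2(\alpha+d_1x_1^2-\alpha x_2^2-(2\alpha+d_3)x_3^2)\,dt+\sigma x_2\,dW_t,\\ dx_3&=x_3(\alpha-(2\alpha+d_2)x_1^2+d_3x_2^2-\alpha x_3^2)\,dt+\sigma x_3\,dW_t,\end{aligned}$$ and (D) is the deterministic system obtained with $\sigma=0$. $\mu_Q$ is the law of $u_gQ$, where $u_g=\big(2\alpha\int_{-\infty}^0\exp\{2((\alpha-\tfrac12\sigma^2)s+\sigma W_s)\}ds\big)^{-1/2}$. It is carried by the open ray $\mathcal{L}(Q)=\{\lambda Q:\lambda>0\}$, and $f_Q$ is its density along this ray (with respect to length), extended by $0$ off the ray. P-bifurcation (phenomenological bifurcation) at $\sigma^2=\alpha$ means a qualitative change of the shape of the density as $\sigma^2$ crosses $\alpha$; here: along the ray (as a function of $\lambda>0$,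 $x=\lambda Q$) $f_Q$ is unimodal with value (limit) $0$ at $\lambda=0$ when $\sigma^2<\alpha$, while it is decreasing with a pole at $\lambda=0$ when $\alpha<\sigma^2<2\alpha$. *)

(* Defs.v *)
From HB Require Import structures.
From mathcomp Require Import all_boot all_order all_algebra.
From mathcomp Require Import all_classical all_reals all_analysis.

Set Implicit Arguments.
Unset Strict Implicit.
Unset Printing Implicit Defensive.

Import Order.TTheory GRing.Theory Num.Theory.
Import numFieldNormedType.Exports.

Local Open Scope classical_set_scope.
Local Open Scope ring_scope.

Definition increment (R : realType) (Omega : Type) (W : R -> Omega -> R)
    (s t : R) (w : Omega) : R :=
  W t w - W s w.

(* The condition on the sequences [t] and [A] is the product rule for
   consecutive increments; since the [A i] may be [setT], it expresses mutual
   independence. Paths are continuous for every [w], so that path integrals are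
   random variables even when [P] is not complete. *)
Definition two_sided_brownian_motion (R : realType) (d : measure_display)
    (Omega : measurableType d) (P : probability Omega R)
    (W : R -> Omega -> R) : Prop :=
  [/\ forall t, measurable_fun [set: Omega] (W t),
      {ae P, forall w, W 0 w = 0},
      forall w, continuous (fun t => W t w),
      forall s t, s < t -> forall A : set R, measurable A ->
        P (increment W s t @^-1` A) =
        normal_prob 0 (Num.sqrt (t - s)) A
    & forall (n : nat) (t : nat -> R) (A : nat -> set R),
        (forall i, t i <= t i.+1) -> (forall i, measurable (A i)) ->
        P (\bigcap_(i < n) (increment W (t i) (t i.+1) @^-1` A i)) =
        (\prod_(i < n) P (increment W (t i) (t i.+1) @^-1` A i))%E].

Definition drift (R : realType) (alpha d1 d2 d3 : R) (x : R * R * R) :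
    R * R * R :=
  let: (x1, x2, x3) := x in
  (x1 * (alpha - alpha * x1 ^+ 2 - (2 * alpha + d1) * x2 ^+ 2 + d2 * x3 ^+ 2),
   x2 * (alpha + d1 * x1 ^+ 2 - alpha * x2 ^+ 2 - (2 * alpha + d3) * x3 ^+ 2),
   x3 * (alpha - (2 * alpha + d2) * x1 ^+ 2 + d3 * x2 ^+ 2 - alpha * x3 ^+ 2)).

Definition octant (R : realType) : set (R * R * R) :=
  [set x | [/\ 0 <= x.1.1, 0 <= x.1.2 & 0 <= x.2]].
Arguments octant : clear implicits.

Definition origin (R : realType) : R * R * R := (0, 0, 0).

Definition equilibrium (R : realType) (alpha d1 d2 d3 : R) (Q : R * R * R) :
    Prop :=
  drift alpha d1 d2 d3 Q = origin R.

Definition dilate (R : realType) (l : R) (x : R * R * R) : R * R * R :=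
  (l * x.1.1, l * x.1.2, l * x.2).

(* The norm of the library on products is the sup norm. *)
Definition euclid_norm (R : realType) (x : R * R * R) : R :=
  Num.sqrt (x.1.1 ^+ 2 + x.1.2 ^+ 2 + x.2 ^+ 2).

Definition open_ray (R : realType) (Q : R * R * R) : set (R * R * R) :=
  [set x | exists2 l : R, 0 < l & x = dilate l Q].

(* When the integral is infinite, [fine] makes this 0, the value given by the
   convention [(+oo) ^ (-1/2) = 0]. *)
Definition u_g (R : realType) (d : measure_display) (Omega : measurableType d)
    (W : R -> Omega -> R) (alpha sigma : R) (w : Omega) : R :=
  (2 * alpha *
   fine (\int[@lebesgue_measure R]_(s in `]-oo, 0])
     (expR (2 * ((alpha - 2^-1 * sigma ^+ 2) * s + sigma * W s w)))%:E))
  `^ (- 2^-1).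

Definition mu_Q (R : realType) (d : measure_display) (Omega : measurableType d)
    (P : probability Omega R) (W : R -> Omega -> R) (alpha : R)
    (Q : R * R * R) (sigma : R) : set (R * R * R) -> \bar R :=
  pushforward P (fun w => dilate (u_g W alpha sigma w) Q).

(* Density with respect to length on the ray, which is parametrised by the
   Euclidean distance [r] to the origin; continuity along the ray selects a
   single version of the density. *)
Definition ray_density (R : realType) (Q : R * R * R)
    (mu : set (R * R * R) -> \bar R) (f : R * R * R -> R) : Prop :=
  [/\ forall x, 0 <= f x,
      forall x, ~ open_ray Q x -> f x = 0,
      forall l : R, 0 < l -> {for l, continuous (fun k : R => f (dilate k Q))}
    & forall A : set (R * R * R), measurable A ->
        mu A = (\int[@lebesgue_measure R]_(r in
                  [set r : R | 0 < r /\ A (dilate (r / euclid_norm Q) Q)]%R)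
                  (f (dilate (r / euclid_norm Q)%R Q))%:E)%E].

Definition density_family (R : realType) (d : measure_display)
    (Omega : measurableType d) (P : probability Omega R) (W : R -> Omega -> R)
    (alpha : R) (Q : R * R * R) (f : R -> R * R * R -> R) : Prop :=
  forall sigma : R, 0 < sigma ^+ 2 < 2 * alpha ->
    ray_density Q (mu_Q P W alpha Q sigma) (f sigma).

Definition strictly_unimodal (R : realType) (g : R -> R) : Prop :=
  exists2 m : R, 0 < m &
    (forall x y : R, 0 < x -> x < y -> y <= m -> g x < g y) /\
    (forall x y : R, m <= x -> x < y -> g y < g x).

Definition strictly_decreasing (R : realType) (g : R -> R) : Prop :=
  forall x y : R, 0 < x -> x < y -> g y < g x.

Definition P_bifurcation (R : realType) (alpha : R) (Q : R * R * R)
    (f : R -> R * R * R -> R) : Prop :=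
  (forall sigma : R, 0 < sigma ^+ 2 < alpha ->
     strictly_unimodal (fun l => f sigma (dilate l Q)) /\
     f sigma (dilate l Q) @[l --> 0^'+] --> 0) /\
  (forall sigma : R, alpha < sigma ^+ 2 < 2 * alpha ->
     strictly_decreasing (fun l => f sigma (dilate l Q)) /\
     f sigma (dilate l Q) @[l --> 0^'+] --> +oo).

(* Main.v *)
Require Import Defs.
From HB Require Import structures.
From mathcomp Require Import all_boot all_order all_algebra.
From mathcomp Require Import all_classical all_reals all_analysis.
From mathcomp Require Import measurable_realfun ring lra.
Import Order.TTheory GRing.Theory Num.Theory.
Import numFieldNormedType.Exports.
Local Open Scope classical_set_scope.
Local Open Scope ring_scope.

(** The theorem rests on the explicit law of $u_g$. Put
    $\mu=\alpha/\sigma^2-1/2>0$. The integral in the definition of $u_g$ is, after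
    time reversal, $J=\int_0^\infty y_t\,dt$ for the geometric Brownian motion
    $y_t=e^{2(\sigma B_t-\mu\sigma^2t)}$, and Dufresne's identity
    ([gbm_total_law]) says that $2\sigma^2J$ has the inverse gamma law of index
    $\mu$. Hence $u_g=(2\alpha J)^{-1/2}$ has the density proportional to
    $l^{2\mu-1}e^{-\alpha l^2/\sigma^2}$ on the half-line, with
    $2\mu-1=2(\alpha/\sigma^2-1)$: a positive power of $l$ below the bifurcation,
    a negative one above it. The shape of the density can be read off from this
    formula ([profile_increasing], [profile_decreasing], [profile_cvg0],
    [profile_cvgy]).

    Dufresne's identity is proved without stochastic calculus. Let $R$ be the
    distribution function of the inverse gamma law, without normalisation, and
    let $A_t=\int_0^ty_u\,du$. The ratio $r_t=(2\sigma^2b-2\sigma^2A_t)/y_t$ is a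
    Markov process which tends to $+\infty$ if $J<b$ and becomes negative if
    $J>b$; there $R$ takes its limit $\Gamma(\mu)$ and the value $0$. If $R(r_t)$ has
    constant expectation, letting $t$ tend to infinity gives
    $\Gamma(\mu)\,P(J\le b)=R(2\sigma^2b)$.

    The expectation of $R(r_t)$ is constant because $R$ is a scale function. In
    discrete time, with step $h$, the ratio becomes a Markov chain $r\mapsto
    (r-2\sigma^2h)e^{\xi}$ with Gaussian $\xi$, and one step changes the
    expectation of $R$ by $O(h^{3/2})$, uniformly in the state
    ([drift_shift_balance], [chain_step_invariance]). Over $T/h$ steps the error
    is $O(h^{1/2})$ ([chain_expectation]), and as $h$ tends to $0$ the chain
    converges to $r_T$ because Riemann sums of the continuous path converge
    ([cum_gbm_expectation]).

    Finally, a density that is continuous along the ray is determined by the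
    measure ([continuous_density_unique]), so every admissible family agrees
    with the explicit one on the ray. *)

Set Implicit Arguments.
Unset Strict Implicit.
Unset Printing Implicit Defensive.

(** * Mean value and Taylor estimates *)

Section taylor.
Variable R : realType.

Lemma is_derive_continuous (f df : R -> R) :
  (forall x : R, is_derive x 1 f (df x)) -> continuous f.
Proof.
by move=> fdf x; apply/differentiable_continuous/derivable1_diffP; have [] := fdf x.
Qed.

(** The sign of the increment is free, so that Gaussian increments can be
    inserted below. *)
Lemma mean_value (f df : R -> R) (x s : R) :
  (forall x : R, is_derive x 1 f (df x)) ->
  exists2 c, `|c| <= `|s| & f (x + s) - f x = df (x + c) * s.
Proof.
move=> fdf; have cf := is_derive_continuous fdf.
have [s0|s0] := leP 0 s.
- have xs : x <= x + s by rewrite lerDl.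
  have [|c] := @MVT_segment R f df x (x + s) xs (fun x _ => fdf x).
    exact: continuous_subspaceT.
  rewrite in_itv/= => /andP[xc cs] ->; exists (c - x).
    by rewrite !ger0_norm// ?subr_ge0// lerBlDl.
  by congr (df _ * _); ring.
- have xs : x + s <= x by rewrite gerDl ltW.
  have [|c] := @MVT_segment R f df (x + s) x xs (fun x _ => fdf x).
    exact: continuous_subspaceT.
  rewrite in_itv/= => /andP[xc cs] E; exists (c - x).
    by rewrite (ler0_norm (ltW s0)) ler0_norm ?subr_le0//; lra.
  have -> : x + (c - x) = c by ring.
  by rewrite -opprB E; ring.
Qed.

Lemma taylor1 (f f1 f2 : R -> R) (C x s : R) :
  (forall x : R, is_derive x 1 f (f1 x)) -> (forall x : R, is_derive x 1 f1 (f2 x)) ->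
  (forall x, `|f2 x| <= C) ->
  `|f (x + s) - f x - f1 x * s| <= C * s ^+ 2.
Proof.
move=> df df1 f2C.
have [c cs ->] := mean_value x s df.
have [e ec E] := mean_value x c df1.
rewrite -mulrBl E !normrM -(real_normK (num_real s)) expr2 mulrA.
by rewrite ler_wpM2r// ler_pM.
Qed.

Lemma taylor2 (f f1 f2 f3 : R -> R) (C x s : R) :
  (forall x : R, is_derive x 1 f (f1 x)) -> (forall x : R, is_derive x 1 f1 (f2 x)) ->
  (forall x : R, is_derive x 1 f2 (f3 x)) -> (forall x, `|f3 x| <= C) ->
  `|f (x + s) - f x - f1 x * s - f2 x * s ^+ 2 / 2| <= C * `|s| ^+ 3.
Proof.
move=> df df1 df2 f3C.
pose k (u : R) := f (x + u) - f1 x * u - f2 x * u ^+ 2 / 2.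
pose dk (u : R) := f1 (x + u) - f1 x - f2 x * u.
have dkP (u : R) : is_derive u 1 k (dk u).
  have dfx : is_derive u 1 (fun u => f (x + u)) (f1 (x + u)).
    have H : is_derive u 1 (fun u => x + u) (1 : R).
      by apply: is_derive_eq; rewrite add0r mulr1.
    by have := @is_derive1_comp R f (fun u => x + u) u _ _ (df (x + u)) H; rewrite mulr1.
  rewrite /k /dk; apply: is_derive_eq.
  rewrite ?scaler0 ?scale0r ?addr0 ?add0r /GRing.scale/= ?expr1 ?mulr1.
  by field.
have [c cs] := mean_value 0 s dkP.
rewrite !add0r /k /dk addr0 mulr0 expr0n/= mulr0 mul0r !subr0 => E.
have -> : f (x + s) - f x - f1 x * s - f2 x * s ^+ 2 / 2 =
   f (x + s) - f1 x * s - f2 x * s ^+ 2 / 2 - f x by ring.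
rewrite E normrM exprSr mulrA ler_wpM2r//.
apply: (le_trans (taylor1 x c df1 df2 f3C)).
rewrite -(real_normK (num_real c)) ler_wpM2l//.
  exact: le_trans (f3C 0).
by rewrite ler_sqr ?nnegrE.
Qed.

End taylor.

(** * The inverse gamma distribution function *)

Section inverse_gamma.
Variable R : realType.
Implicit Types a m r t x z : R.

(** The maximum over $z$ of $e^{az-e^z}$, attained at $z=\ln a$. *)
Definition exp_bound a : R := expR (a * ln a - a).

Lemma le_exp_bound a z : 0 < a -> expR (a * z - expR z) <= exp_bound a.
Proof.
move=> a0; rewrite ler_expR.
have -> : expR z = a * expR (z - ln a).
  by rewrite expRB lnK ?posrE// mulrC divfK// gt_eqF.
have : a * (1 + (z - ln a)) <= a * expR (z - ln a).
  by rewrite ler_wpM2l ?expR_ge1Dx// ltW.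
lra.
Qed.

(** The inverse gamma density of index [m], without its normalising constant. *)
Definition invgamma_fun m t : R :=
  if 0 < t then expR (- (m + 1) * ln t - t^-1) else 0.

Lemma invgamma_fun_ge0 m t : 0 <= invgamma_fun m t.
Proof. by rewrite /invgamma_fun; case: ifP => // _; exact: expR_ge0. Qed.

Lemma invgamma_fun_neg m t : t <= 0 -> invgamma_fun m t = 0.
Proof. by rewrite /invgamma_fun ltNge => ->. Qed.

(** In the variable $z=-\ln t$ the quotient by $t^n$ is again of the form
    $e^{az-e^z}$: the density is flatter at the origin than every power. *)
Lemma invgamma_fun_le m (n : nat) t : 0 < m ->
  invgamma_fun m t <= exp_bound (m + 1 + n%:R) * `|t| ^+ n.
Proof.
move=> m0; rewrite /invgamma_fun; case: ifPn => [t0|_]; last first.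
  by rewrite mulr_ge0// ?expR_ge0.
rewrite gtr0_norm//.
have -> : expR (- (m + 1) * ln t - t^-1) =
    expR ((m + 1 + n%:R) * (- ln t) - expR (- ln t)) * t ^+ n.
  rewrite -[in X in _ = _ * X](lnK (t0 : t \in Num.pos)) -expRM_natl -expRD.
  by rewrite expRN lnK//; congr expR; ring.
rewrite ler_wpM2r//; first by rewrite exprn_ge0// ltW.
by rewrite le_exp_bound// -addrA ltr_pwDl.
Qed.

Definition invgamma_dfun m t : R := (t ^- 2 - (m + 1) / t) * invgamma_fun m t.

(** Since the density vanishes at the origin to second order, it is
    differentiable on the whole line; later estimates then need no case
    distinction at the origin. *)
Lemma is_derive_invgamma_fun m t : 0 < m ->
  is_derive t 1 (invgamma_fun m) (invgamma_dfun m t).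
Proof.
move=> m0; have [t0|t0|->] := ltgtP t 0.
- rewrite /invgamma_dfun invgamma_fun_neg ?mulr0 ?ltW//.
  apply: (@near_eq_is_derive _ _ _ (cst (0 : R))).
  near=> s; rewrite invgamma_fun_neg//.
  by apply: ltW; near: s; exact: lt_nbhsl.
- rewrite /invgamma_dfun {2}/invgamma_fun t0.
  apply: (@near_eq_is_derive _ _ _ (expR \o (fun s => - (m + 1) * ln s - s^-1))).
    near=> s; rewrite /invgamma_fun/= ifT//.
    by near: s; apply: lt_nbhsr.
  rewrite mulrC; apply: is_derive1_comp.
  have H1 := is_derive1_ln t0.
  have H2 : is_derive t (1:R) (fun s : R => s^-1) (- t ^- 2 *: (1:R)).
    by apply: (@is_deriveV _ id); rewrite ?gt_eqF.
  apply: is_derive_eq; rewrite /GRing.scale/= ?mulr0 ?addr0 ?add0r.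
  by field; rewrite gt_eqF.
- rewrite /invgamma_dfun invgamma_fun_neg// mulr0.
  apply/is_derive1_caratheodory; exists (fun z => invgamma_fun m z / z).
  rewrite invgamma_fun_neg// mul0r; split => //.
    move=> z; rewrite !subr0; have [->|z0] := eqVneq z 0.
      by rewrite invgamma_fun_neg// mulr0.
    by rewrite divfK.
  rewrite /prop_for /continuous_at/= invr0 mulr0.
  apply/cvgr0Pnorm_le => e e0.
  pose M := exp_bound (m + 1 + 2%:R).
  have M0 : 0 < M by exact: expR_gt0.
  near=> z.
  have [->|z0] := eqVneq z 0; first by rewrite invgamma_fun_neg// mul0r normr0 ltW.
  rewrite normrM (ger0_norm (invgamma_fun_ge0 _ _)) normfV ler_pdivrMr ?normr_gt0//.
  apply: le_trans (invgamma_fun_le 2 z m0) _.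
  rewrite -/M expr2 mulrA ler_wpM2r// -ler_pdivlMl//.
  near: z; apply: (@nbhs0_le R R); rewrite ?mulr_gt0 ?invr_gt0//.
Unshelve. all: by end_near. Qed.

Lemma continuous_invgamma_fun m : 0 < m -> continuous (invgamma_fun m).
Proof.
by move=> m0; apply: is_derive_continuous => x; exact: is_derive_invgamma_fun.
Qed.

Definition invgamma_dfun_bound m : R :=
  exp_bound (m + 1 + 2%:R) + (m + 1) * exp_bound (m + 1 + 1%:R).

Lemma invgamma_dfun_le m t : 0 < m -> `|invgamma_dfun m t| <= invgamma_dfun_bound m.
Proof.
move=> m0; rewrite /invgamma_dfun.
have [t0|t0] := leP t 0.
  rewrite invgamma_fun_neg// mulr0 normr0 /invgamma_dfun_bound.
  by rewrite addr_ge0// ?mulr_ge0// ?expR_ge0// addr_ge0// ltW.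
have g0 := invgamma_fun_ge0 m t.
rewrite mulrBl (le_trans (ler_normB _ _))// /invgamma_dfun_bound lerD//.
- rewrite ger0_norm; last by rewrite mulr_ge0// invr_ge0 exprn_ge0// ltW.
  rewrite mulrC ler_pdivrMr ?exprn_gt0//.
  by have := invgamma_fun_le 2 t m0; rewrite (gtr0_norm t0).
- rewrite ger0_norm; last first.
    by rewrite mulr_ge0// divr_ge0// ?ltW// addr_gt0.
  rewrite -mulrA ler_wpM2l//; first by rewrite addr_ge0// ltW.
  rewrite mulrC ler_pdivrMr//.
  by have := invgamma_fun_le 1 t m0; rewrite (gtr0_norm t0) expr1.
Qed.

Lemma integrable_invgamma_fun m u : 0 < m ->
  (@lebesgue_measure R).-integrable [set` `]-oo, u]] (EFin \o invgamma_fun m).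
Proof.
move=> m0.
apply/integrable_mkcond => //.
have -> : (EFin \o invgamma_fun m) \_ [set` `]-oo, u]] =
          (EFin \o invgamma_fun m) \_ [set` `[0, u]].
  apply/funext => x; rewrite !patchE !mem_setE !in_itv/=.
  by case: (leP 0 x) => //= x0; case: ifP => //= _;
    rewrite invgamma_fun_neg// ltW.
apply/(iffLR (integrable_mkcond _ _)) => //.
apply: continuous_compact_integrable; first exact: segment_compact.
by apply: continuous_subspaceT; exact: continuous_invgamma_fun.
Qed.

Definition invgamma_cum m r : R :=
  \int[lebesgue_measure]_(t in [set` `]-oo, r]]) invgamma_fun m t.

Lemma is_derive_invgamma_cum m r : 0 < m ->
  is_derive r 1 (invgamma_cum m) (invgamma_fun m r).
Proof.
move=> m0; have r1 : r < r + 1 by rewrite ltrDl.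
have [] := continuous_FTC1 (a := -oo%O) r1 (integrable_invgamma_fun (r + 1) m0).
- by rewrite ltNyr.
- exact: continuous_invgamma_fun.
- move=> dF F'; apply: DeriveDef; first exact: dF.
  by rewrite -derive1E; exact: F'.
Qed.

Lemma continuous_invgamma_cum m : 0 < m -> continuous (invgamma_cum m).
Proof.
by move=> m0; apply: is_derive_continuous => x; exact: is_derive_invgamma_cum.
Qed.

Lemma invgamma_cum_neg m r : r <= 0 -> invgamma_cum m r = 0.
Proof.
move=> r0; rewrite /invgamma_cum (@eq_Rintegral _ _ _ _ _ (cst 0)) ?Rintegral_cst ?mul0r//.
by move=> x; rewrite inE/= in_itv/= => xr; rewrite invgamma_fun_neg// (le_trans xr).
Qed.

Lemma nondecreasing_invgamma_cum m : 0 < m ->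
  {homo invgamma_cum m : x y / x <= y}.
Proof.
move=> m0 x y xy; rewrite -subr_ge0.
have [c _] := mean_value x (y - x) (fun z => is_derive_invgamma_cum z m0).
rewrite subrKC => ->.
by rewrite mulr_ge0 ?invgamma_fun_ge0 ?subr_ge0.
Qed.

Lemma invgamma_cum_ge0 m r : 0 < m -> 0 <= invgamma_cum m r.
Proof.
move=> m0; have [r0|r0] := leP r 0; first by rewrite invgamma_cum_neg.
by rewrite -(invgamma_cum_neg m (lexx 0)) nondecreasing_invgamma_cum// ltW.
Qed.

Lemma invgamma_cum_gt0 m r : 0 < m -> 0 < r -> 0 < invgamma_cum m r.
Proof.
move=> m0 r0.
have [|c] := MVT r0 (fun z _ => is_derive_invgamma_cum z m0).
  by apply: continuous_subspaceT; exact: continuous_invgamma_cum.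
rewrite in_itv/= (invgamma_cum_neg m (lexx 0)) !subr0 => /andP[c0 _] ->.
by rewrite mulr_gt0// /invgamma_fun c0 expR_gt0.
Qed.

(** On $[1,r]$ the density is at most $t^{-m-1}$, so [invgamma_cum m t] plus
    $t^{-m}/m$ does not increase there. *)
Lemma invgamma_cum_le m r : 0 < m -> invgamma_cum m r <= invgamma_cum m 1 + m^-1.
Proof.
move=> m0; have [r1|r1] := leP r 1.
  by rewrite -[leLHS]addr0 lerD ?nondecreasing_invgamma_cum// invr_ge0 ltW.
pose F (t : R) := invgamma_cum m t + expR (- m * ln t) / m.
pose dF (t : R) := invgamma_fun m t - expR (- m * ln t) / t.
have dFP (t : R) : 0 < t -> is_derive t 1 F (dF t).
  move=> t0; have H1 := is_derive1_ln t0.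
  have H2 := is_derive_invgamma_cum t m0.
  have H3 : is_derive t (1:R) (fun t => - m * ln t) (- m * t^-1).
    by apply: is_derive_eq; rewrite /GRing.scale/= ?mulr0 ?addr0.
  have H4 := is_derive1_comp (is_derive_expR _) H3.
  rewrite /F /dF; apply: is_derive_eq.
  rewrite /GRing.scale/= ?mulr0 ?add0r ?addr0. field.
  by rewrite !gt_eqF.
have [t t1||c] := @MVT R F dF 1 r r1.
- by apply: dFP; rewrite (lt_trans ltr01)//; move: t1; rewrite in_itv/= => /andP[].
- apply: derivable_within_continuous => t; rewrite in_itv/= => /andP[t1 _].
  by have [] := dFP t (lt_le_trans ltr01 t1).
- rewrite in_itv/= => /andP[c1 cr] E.
  have c0 : 0 < c by rewrite (lt_trans ltr01).
  have : F r - F 1 <= 0.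
    rewrite E mulr_le0_ge0// ?subr_ge0 ?(ltW r1)// /dF subr_le0.
    have -> : c^-1 = expR (- ln c) by rewrite expRN lnK.
    rewrite /invgamma_fun c0 -expRD ler_expR.
    have : 0 <= c^-1 by rewrite invr_ge0 ltW.
    lra.
  rewrite /F ln1 mulr0 expR0 mul1r.
  have : 0 <= expR (- m * ln r) / m by rewrite divr_ge0 ?expR_ge0// ltW.
  lra.
Qed.

(** This number is $\Gamma(m)$. *)
Definition invgamma_mass m : R := sup (range (invgamma_cum m)).

Lemma invgamma_cum_has_ubound m : 0 < m -> has_ubound (range (invgamma_cum m)).
Proof.
move=> m0; exists (invgamma_cum m 1 + m^-1) => _ [r _ <-].
exact: invgamma_cum_le.
Qed.

Lemma invgamma_cum_le_mass m r : 0 < m -> invgamma_cum m r <= invgamma_mass m.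
Proof.
by move=> m0; apply: ub_le_sup; [exact: invgamma_cum_has_ubound|exists r].
Qed.

Lemma invgamma_mass_gt0 m : 0 < m -> 0 < invgamma_mass m.
Proof.
move=> m0; apply: lt_le_trans (invgamma_cum_le_mass 1 m0).
exact: invgamma_cum_gt0.
Qed.

Lemma cvg_invgamma_cum m : 0 < m ->
  invgamma_cum m r @[r --> +oo] --> invgamma_mass m.
Proof.
move=> m0; apply: nondecreasing_cvgr.
  by move=> x y; exact: nondecreasing_invgamma_cum.
exact: invgamma_cum_has_ubound.
Qed.

End inverse_gamma.

Opaque invgamma_cum invgamma_mass.

(** * The distribution function on the logarithmic scale *)

Section log_scale.
Variables (R : realType) (m : R).
Hypothesis m0 : 0 < m.
Implicit Types x : R.

(** The function [log_cum0] is the distribution function as a function of the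
    logarithm; [log_cum1], [log_cum2] and [log_cum3] are its derivatives. All of
    them are bounded, which makes Taylor estimates uniform in the state. *)
Definition log_cum0 x : R := invgamma_cum m (expR x).
Definition log_cum1 x : R := expR (- m * x - expR (- x)).
Definition log_cum2 x : R := (expR (- x) - m) * log_cum1 x.
Definition log_cum3 x : R := ((expR (- x) - m) ^+ 2 - expR (- x)) * log_cum1 x.

Lemma log_cum1E x : log_cum1 x = invgamma_fun m (expR x) * expR x.
Proof.
rewrite /log_cum1 /invgamma_fun expR_gt0 expRK -expRN -expRD.
by congr expR; ring.
Qed.

Lemma log_cum0E x : log_cum0 x = invgamma_cum m (expR x).
Proof. by []. Qed.

Lemma is_derive_expRN x : is_derive x 1 (fun y => expR (- y)) (- expR (- x)).
Proof.
have H : is_derive x (1:R) (fun y : R => - y) (- 1 : R) by apply: is_derive_eq.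
by have := is_derive1_comp (is_derive_expR _) H; rewrite mulrN1.
Qed.

Lemma is_derive_log_cum0 x : is_derive x 1 log_cum0 (log_cum1 x).
Proof.
rewrite log_cum1E.
exact: is_derive1_comp (is_derive_invgamma_cum _ m0) (is_derive_expR _).
Qed.

Lemma is_derive_log_cum1 x : is_derive x 1 log_cum1 (log_cum2 x).
Proof.
have H := is_derive_expRN x.
have H1 : is_derive x (1:R) (fun x : R => - m * x - expR (- x)) (expR (- x) - m).
  by apply: is_derive_eq; rewrite /GRing.scale/= ?mulr0 ?addr0 ?mulr1; ring.
by have := is_derive1_comp (is_derive_expR _) H1; rewrite /log_cum2 mulrC.
Qed.

Lemma is_derive_log_cum2 x : is_derive x 1 log_cum2 (log_cum3 x).
Proof.
have H := is_derive_expRN x.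
have H1 := is_derive_log_cum1 x.
rewrite /log_cum2 /log_cum3; apply: is_derive_eq.
by rewrite /log_cum2 /GRing.scale/= ?subr0; ring.
Qed.

Lemma log_cum1_ge0 x : 0 <= log_cum1 x. Proof. exact: expR_ge0. Qed.

Lemma log_cum1_le (n : nat) x :
  expR (- x) ^+ n * log_cum1 x <= exp_bound (m + n%:R).
Proof.
rewrite -expRM_natl -expRD.
have -> : n%:R * - x + (- m * x - expR (- x)) = (m + n%:R) * - x - expR (- x).
  by ring.
by apply: le_exp_bound; rewrite ltr_pwDl.
Qed.

Definition log_cum_bound : R :=
  m * exp_bound (m + 0%:R) + exp_bound (m + 1%:R) +
  (m ^+ 2 * exp_bound (m + 0%:R) + m * exp_bound (m + 1%:R) *+ 2
   + exp_bound (m + 2%:R) + exp_bound (m + 1%:R)).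

Lemma log_cum2_le x : `|log_cum2 x| <= log_cum_bound.
Proof.
have l0 := log_cum1_le 0 x; have l1 := log_cum1_le 1 x.
have p := log_cum1_ge0 x.
have b j : 0 <= exp_bound (m + j%:R) by exact: expR_ge0.
have m2 : 0 <= m ^+ 2 by rewrite sqr_ge0.
rewrite /log_cum2 mulrBl (le_trans (ler_normB _ _))// /log_cum_bound.
rewrite expr0 mul1r in l0; rewrite expr1 in l1.
rewrite !ger0_norm ?mulr_ge0 ?expR_ge0 ?(ltW m0)//.
have := ler_wpM2l (ltW m0) l0.
have := b 1%N; have := b 2; have := mulr_ge0 m2 (b 0%N).
have := mulr_ge0 (ltW m0) (b 1%N).
lra.
Qed.

Lemma log_cum3_le x : `|log_cum3 x| <= log_cum_bound.
Proof.
have l0 := log_cum1_le 0 x; have l1 := log_cum1_le 1 x.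
have l2 := log_cum1_le 2 x.
have p := log_cum1_ge0 x.
have b j : 0 <= exp_bound (m + j%:R) by exact: expR_ge0.
have m2 : 0 <= m ^+ 2 by rewrite sqr_ge0.
rewrite expr0 mul1r in l0; rewrite expr1 in l1.
have -> : log_cum3 x = expR (- x) ^+ 2 * log_cum1 x + m ^+ 2 * log_cum1 x -
   (m * (expR (- x) * log_cum1 x) *+ 2 + expR (- x) * log_cum1 x).
  by rewrite /log_cum3; ring.
have e := expR_ge0 (- x).
have e1 := mulr_ge0 e p.
have e2 : 0 <= expR (- x) ^+ 2 * log_cum1 x by rewrite mulr_ge0// exprn_ge0.
have e3 := mulr_ge0 (ltW m0) e1.
have e4 := mulr_ge0 m2 p.
rewrite (le_trans (ler_normB _ _))// !ger0_norm ?addr_ge0 ?mulrn_wge0//.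
rewrite /log_cum_bound.
have := ler_wpM2l (ltW m0) l1; have := ler_wpM2l m2 l0.
have := mulr_ge0 (ltW m0) (b 0%N); have := b 1%N.
lra.
Qed.

(** Write $R$ for the distribution function, $g$ for its density and
    $T(x)=R(e^x)$. The shift of $p$ by $2s^2h$ contributes $2s^2h\,g(p)$ to first
    order in $h$; the drift and the diffusion of the logarithm contribute
    $2ms^2h\,T'+2s^2h\,T''$ at $\ln p$. Both agree because
    $T''=(e^{-x}-m)T'$ and $T'(\ln p)=p\,g(p)$: $R$ is a scale function of the
    chain. *)
Lemma drift_shift_balance (s h p : R) : 0 < p -> 0 <= h ->
  let x := ln p + 2 * (m * s ^+ 2) * h in
  `|invgamma_cum m (p + 2 * s ^+ 2 * h) -
    (log_cum0 x + 2 * s ^+ 2 * h * log_cum2 x)| <=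
  (log_cum_bound * (2 * (m * s ^+ 2)) ^+ 2 +
   2 * s ^+ 2 * (log_cum_bound * (2 * (m * s ^+ 2))) +
   invgamma_dfun_bound m * (2 * s ^+ 2) ^+ 2) * h ^+ 2.
Proof.
move=> p0 h0 /=; set u := 2 * (m * s ^+ 2) * h.
have ms0 : 0 <= m * s ^+ 2 by apply: mulr_ge0; [exact: ltW|exact: sqr_ge0].
have u0 : 0 <= u by apply: mulr_ge0 => //; apply: mulr_ge0.
have E1 := taylor1 (ln p) u is_derive_log_cum0 is_derive_log_cum1 log_cum2_le.
have [c _ E2] := mean_value (ln p) u is_derive_log_cum2.
have E2' : `|log_cum2 (ln p + u) - log_cum2 (ln p)| <= log_cum_bound * u.
  by rewrite E2 normrM (ger0_norm u0) ler_wpM2r// log_cum3_le.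
have E3 := taylor1 p (2 * s ^+ 2 * h) (fun x => is_derive_invgamma_cum x m0)
   (fun x => is_derive_invgamma_fun x m0) (fun x => invgamma_dfun_le x m0).
have G : invgamma_fun m p = m * log_cum1 (ln p) + log_cum2 (ln p).
  rewrite /log_cum2 mulrBl addrC subrK log_cum1E lnK// expRN lnK//.
  by field; rewrite gt_eqF.
have L : log_cum0 (ln p) = invgamma_cum m p by rewrite /log_cum0 lnK.
set X := _ - _.
have -> : X = (invgamma_cum m (p + 2 * s ^+ 2 * h) - invgamma_cum m p -
     invgamma_fun m p * (2 * s ^+ 2 * h))
  - (log_cum0 (ln p + u) - log_cum0 (ln p) - log_cum1 (ln p) * u)
  - 2 * s ^+ 2 * h * (log_cum2 (ln p + u) - log_cum2 (ln p)).
  rewrite G L /X /u. ring.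
have sh : 0 <= 2 * s ^+ 2 * h.
  by apply: mulr_ge0 => //; apply: mulr_ge0 => //; exact: sqr_ge0.
have E4 : `|2 * s ^+ 2 * h * (log_cum2 (ln p + u) - log_cum2 (ln p))| <=
   2 * s ^+ 2 * h * (log_cum_bound * u).
  by rewrite normrM (ger0_norm sh) ler_wpM2l.
rewrite (le_trans (ler_normB _ _))// (le_trans (lerD (ler_normB _ _) (lexx _)))//.
apply: le_trans (lerD (lerD E3 E1) E4) _.
rewrite le_eqVlt; apply/orP; left; apply/eqP; rewrite /u. ring.
Qed.

End log_scale.

Opaque log_cum0 log_cum1 log_cum2 log_cum_bound.

(** * Moments of the centred normal law *)

Section integral_of_derivative.
Variable R : realType.
Notation mu := (@lebesgue_measure R).

(** The integrals over $[-n,n]$ tend to the full integral by dominated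
    convergence, and to $0$ by the fundamental theorem of calculus. *)
Lemma integral_derivative0 (f F : R -> R) :
  continuous f -> (forall x : R, is_derive x 1 F (f x)) ->
  mu.-integrable [set: R] (EFin \o f) ->
  F n%:R @[n --> \oo] --> 0 -> F (- n%:R) @[n --> \oo] --> 0 ->
  (\int[mu]_x (f x)%:E = 0)%E.
Proof.
move=> cf dF intf Fy FNy.
pose D (n : nat) : set R := [set` `[- n%:R, n%:R]].
have mf : measurable_fun [set: R] f by exact: continuous_measurable_fun.
have [] := @dominated_convergence _ _ R mu setT measurableT
  (fun n => (EFin \o f) \_ (D n)) (EFin \o f) (abse \o (EFin \o f)).
- move=> n; apply/(measurable_restrictT _ _).1 => //=; first exact: measurable_itv.
  by apply/measurable_EFinP; exact: measurable_funTS.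
- exact/measurable_EFinP.
- apply: aeW => x _; apply: cvg_near_cst.
  near=> n; rewrite patchE mem_set// /D/= in_itv/= -ler_norml.
  by near: n; exact: nbhs_infty_ger.
- exact: integrable_abse.
- apply: aeW => x n _; rewrite patchE; case: ifP => // _.
  by rewrite abse0 abse_ge0.
- move=> _ _ + ; move/cvg_lim => <-//.
apply/cvg_lim => //.
have E n : (0 < n)%N -> (\int[mu]_x (((EFin \o f) \_ (D n)) x) = (F n%:R - F (- n%:R))%:E)%E.
  move=> n0; rewrite -integral_mkcond (@continuous_FTC2 _ f F) ?EFinB//.
  - by rewrite gtrN// ltr0n.
  - exact: continuous_subspaceT.
  - have cF := is_derive_continuous dF.
    split => [x _||]; first by have [] := dF x.
    + exact/cvg_at_right_filter/cF.
    + exact/cvg_at_left_filter/cF.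
  - by move=> x _; rewrite derive1E; have [_ ->] := dF x.
apply: (@cvg_trans _ ((F n%:R - F (- n%:R))%:E @[n --> \oo])).
  by apply: near_eq_cvg; near=> n; apply/esym/E; near: n; exact: nbhs_infty_gt.
apply: cvg_EFin; first exact: nearW.
have := cvgB Fy FNy; rewrite subr0; apply.
Unshelve. all: by end_near. Qed.

End integral_of_derivative.

Section normal_moments.
Variables (R : realType) (s : R).
Hypothesis s0 : 0 < s.
Notation mu := (@lebesgue_measure R).
Notation N := (normal_prob 0 s).
Local Open Scope ereal_scope.

(** The Radon-Nikodym derivative of the normal law is almost everywhere its
    explicit density. *)
Lemma ge0_integral_normal_prob (f : R -> R) : measurable_fun [set: R] f ->
  (forall x, 0 <= f x)%R ->
  \int[N]_x (f x)%:E = \int[mu]_x (f x * normal_pdf 0 s x)%:E.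
Proof.
move=> mf f0.
have dom := normal_prob_dominates (0:R) s.
have f0' x : 0 <= (f x)%:E by rewrite lee_fin.
have mf' := (measurable_EFinP _ _).2 mf.
rewrite -(Radon_Nikodym_SigmaFinite.change_of_variables dom f0' measurableT mf').
apply: ae_eq_integral => //.
- apply: emeasurable_funM; first exact/measurable_EFinP.
  exact: measurable_int (Radon_Nikodym_SigmaFinite.f_integrable dom).
- apply/measurable_EFinP; apply: measurable_funM => //.
  exact: measurable_normal_pdf.
- under [X in ae_eq _ _ _ X]eq_fun do rewrite EFinM.
  apply: ae_eqe_mul2l => /=.
  apply: integral_ae_eq => //=.
  + exact: Radon_Nikodym_SigmaFinite.f_integrable.
  + by apply/measurable_EFinP; exact: measurable_normal_pdf.
  + by move=> E _ mE; rewrite -Radon_Nikodym_SigmaFinite.f_integral.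
Qed.

Lemma integral_normal_prob (f : R -> R) : measurable_fun [set: R] f ->
  \int[N]_x (f x)%:E = \int[mu]_x (f x * normal_pdf 0 s x)%:E.
Proof.
move=> mf; rewrite integralE [RHS]integralE.
have p0 := normal_pdf_ge0 (0:R) s.
congr (_ - _).
- transitivity (\int[N]_x (Num.max (f x) 0)%:E).
    by apply: eq_integral => x _; rewrite funeposE EFin_max.
  rewrite ge0_integral_normal_prob; last 2 first.
  + exact: measurable_maxr.
  + by move=> x; rewrite le_max lexx orbT.
  by apply: eq_integral => x _; rewrite funeposE/= maxr_pMl// mul0r EFin_max.
- transitivity (\int[N]_x (Num.max (- f x) 0)%:E).
    by apply: eq_integral => x _; rewrite funenegE EFin_max.
  rewrite ge0_integral_normal_prob; last 2 first.
  + by apply: measurable_maxr => //; exact: measurableT_comp.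
  + by move=> x; rewrite le_max lexx orbT.
  by apply: eq_integral => x _; rewrite funenegE/= maxr_pMl// mul0r mulNr EFin_max.
Qed.

(** With $w=|x|/s$ this is $w^3\le 16e^{3w^2/8}$; the factor $2$ comes from the
    ratio of the two peaks. *)
Lemma normal_pdf_cube_le x :
  (`|x| ^+ 3 * normal_pdf 0 s x <= 32 * s ^+ 3 * normal_pdf 0 (2 * s) x)%R.
Proof.
have s1 : (2 * s != 0)%R by rewrite mulf_neq0// gt_eqF.
rewrite (normal_pdfE _ (lt0r_neq0 s0)) (normal_pdfE _ s1) /normal_fun !subr0.
have -> : (normal_peak s = 2 * normal_peak (2 * s))%R.
  rewrite /normal_peak.
  have -> : ((2 * s) ^+ 2 * pi *+ 2 = 2 ^+ 2 * (s ^+ 2 * pi *+ 2))%R by ring.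
  rewrite sqrtrM ?sqr_ge0// sqrtr_sqr ger0_norm// invfM mulrA divff ?mul1r//.
pose w := (`|x| / s)%R.
have w0 : (0 <= w)%R by rewrite divr_ge0// ltW.
have xw : (`|x| = w * s)%R by rewrite /w divfK// gt_eqF.
have x2 : (x ^+ 2 = w ^+ 2 * s ^+ 2)%R by rewrite -real_normK ?num_real// xw exprMn.
have -> : (- x ^+ 2 / (s ^+ 2 *+ 2) =
   - x ^+ 2 / ((2 * s) ^+ 2 *+ 2) - 3%:R * w ^+ 2 / 8%:R)%R.
  by rewrite x2; field; rewrite gt_eqF.
rewrite expRD xw exprMn.
have H : (w ^+ 3 * expR (- (3%:R * w ^+ 2 / 8%:R)) <= 16%:R)%R.
  rewrite expRN -ler_pdivlMr ?invr_gt0 ?expR_gt0// invrK.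
  have y0 : (0 <= 3%:R * w ^+ 2 / 8%:R)%R by rewrite divr_ge0// mulr_ge0// sqr_ge0.
  have := expR_ge1Dxn 1 y0; rewrite (_ : 2`! = 2)%N// => H.
  have : (16%:R * (1 + (3%:R * w ^+ 2 / 8%:R) ^+ 2 / 2%:R) <=
          16%:R * expR (3%:R * w ^+ 2 / 8%:R))%R by rewrite ler_wpM2l.
  apply: le_trans.
  have [w1|w1] := leP w 1%R.
    have : (w ^+ 3 <= 1)%R by rewrite exprn_ile1.
    have : (0 <= (3%:R * w ^+ 2 / 8%:R) ^+ 2)%R by rewrite sqr_ge0.
    lra.
  have : (w ^+ 3 <= w ^+ 4)%R by rewrite ler_weXn2l// ltW.
  have : (0 <= w ^+ 4)%R by rewrite exprn_ge0.
  have -> : ((3%:R * w ^+ 2 / 8%:R) ^+ 2 = 9%:R / 64%:R * w ^+ 4 :> R)%R by field.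
  lra.
set e := expR (- x ^+ 2 / _).
have c0 : (0 <= 2 * s ^+ 3 * normal_peak (2 * s) * e)%R.
  by rewrite !mulr_ge0 ?expR_ge0 ?normal_peak_ge0// ltW.
have := ler_wpM2l c0 H.
have -> : (2 * s ^+ 3 * normal_peak (2 * s) * e * 16%:R =
  32 * s ^+ 3 * (normal_peak (2 * s) * e))%R by ring.
by apply: le_trans; rewrite le_eqVlt; apply/orP; left; apply/eqP; ring.
Qed.

End normal_moments.

Section normal_moments_values.
Variables (R : realType) (s : R).
Hypothesis s0 : 0 < s.
Notation mu := (@lebesgue_measure R).
Notation N := (normal_prob 0 s).

Lemma is_derive_normal_pdf (x : R) :
  is_derive x 1 (normal_pdf 0 s) (- (x / s ^+ 2) * normal_pdf 0 s x).
Proof.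
rewrite normal_pdfE ?gt_eqF// /normal_fun.
have H : is_derive x (1:R) (fun x => - (x - 0) ^+ 2 / (s ^+ 2 *+ 2)) (- (x / s ^+ 2)).
  apply: is_derive_eq; rewrite /GRing.scale/= ?mulr0 ?add0r ?addr0 ?subr0 ?mulr1 ?expr1.
  by field; rewrite gt_eqF.
have H1 := is_derive1_comp (is_derive_expR _) H.
apply: is_derive_eq; rewrite /GRing.scale/= ?mulr0 ?addr0; ring.
Qed.

(** Cubic growth suffices: by [normal_pdf_cube_le] the cube is absorbed by a
    Gaussian of twice the standard deviation. *)
Lemma integrable_cube_normal_pdf (f : R -> R) (a : R) :
  measurable_fun [set: R] f -> (forall x, `|f x| <= a * (1 + `|x| ^+ 3)) ->
  mu.-integrable [set: R] (fun x => (f x * normal_pdf 0 s x)%:E).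
Proof.
move=> mf fa.
have a0 : 0 <= a.
  by have := fa 0; rewrite normr0 expr0n/= addr0 mulr1; apply: le_trans.
pose g x := a * normal_pdf 0 s x + a * 32 * s ^+ 3 * normal_pdf 0 (2 * s) x.
have ig : mu.-integrable [set: R] (fun x => (g x)%:E).
  rewrite /g; under eq_fun do rewrite EFinD.
  apply: integrableD => //.
    under eq_fun do rewrite EFinM.
    by apply: integrableZl => //; exact: integrable_normal_pdf.
  under eq_fun do rewrite EFinM.
  by apply: integrableZl => //; exact: integrable_normal_pdf.
apply: (le_integrable _ _ _ ig) => //.
  apply/measurable_EFinP; apply: measurable_funM => //.
  exact: measurable_normal_pdf.
move=> x _; rewrite lee_fin.
have p0 := normal_pdf_ge0 0 s x.
rewrite normrM (ger0_norm p0) (le_trans (ler_wpM2r p0 (fa x)))//.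
rewrite (le_trans _ (ler_norm _))// /g mulrDr mulr1 mulrDl lerD2l.
by have := ler_wpM2l a0 (normal_pdf_cube_le s0 x); rewrite !mulrA.
Qed.

Lemma integrable_cube_normal_prob (f : R -> R) (a : R) :
  measurable_fun [set: R] f -> (forall x, `|f x| <= a * (1 + `|x| ^+ 3)) ->
  N.-integrable [set: R] (EFin \o f).
Proof.
move=> mf fa; apply/integrableP; split; first exact/measurable_EFinP.
have -> : (\int[N]_x `|(EFin \o f) x| = \int[N]_x (`|f x|)%:E)%E by [].
rewrite ge0_integral_normal_prob//; last exact: measurableT_comp.
have /integrableP[_] := integrable_cube_normal_pdf mf fa.
apply: le_lt_trans; rewrite le_eqVlt; apply/orP; left; apply/eqP.
apply: eq_integral => x _.
by rewrite [in RHS]/= normrM (ger0_norm (normal_pdf_ge0 0 s x)).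
Qed.

Lemma abs_le_cube (x : R) :
  `|x| <= 1 * (1 + `|x| ^+ 3).
Proof.
rewrite mul1r; have [x1|x1] := leP `|x| 1.
  by rewrite (le_trans x1)// lerDl exprn_ge0.
by apply: ler_wpDl => //; rewrite ler_eXnr// ltW.
Qed.

Lemma sqr_le_cube (x : R) : `|x ^+ 2| <= 1 * (1 + `|x| ^+ 3).
Proof.
rewrite normrX mul1r; have [x1|x1] := leP `|x| 1.
  by rewrite (@le_trans _ _ 1) ?exprn_ile1// lerDl exprn_ge0.
by apply: ler_wpDl => //; rewrite ler_weXn2l// ltW.
Qed.

Let cvg_tail (F : R -> R) (K : R) : (forall x, `|x| ^+ 2 * `|F x| <= K) ->
  F n%:R @[n --> \oo] --> 0 /\ F (- n%:R) @[n --> \oo] --> 0.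
Proof.
move=> FK.
have K0 : 0 <= K by apply: le_trans (FK 0); rewrite mulr_ge0// exprn_ge0.
suff H : forall g : nat -> R, (forall n, `|g n| = n%:R) -> F (g n) @[n --> \oo] --> 0.
  by split; apply: H => n; rewrite ?normrN normr_nat.
move=> g gn; apply/cvgr0Pnorm_le => e e0; near=> n.
have n1 : (1 <= n%:R :> R) by near: n; exact: nbhs_infty_ger.
have n0 : (0 < n%:R :> R) by rewrite (lt_le_trans ltr01).
have Kn : K <= n%:R * e by rewrite -ler_pdivrMr//; near: n; exact: nbhs_infty_ger.
have := FK (g n); rewrite gn => H.
rewrite -(ler_pM2l n0) -(ler_pM2l n0) mulrA -expr2 (le_trans H)// (le_trans Kn)//.
by rewrite ler_peMl// mulr_ge0// ltW.
Unshelve. all: by end_near. Qed.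

Let cube_pdf_le (x : R) : `|x| ^+ 3 * normal_pdf 0 s x <= 32 * s ^+ 3 * normal_peak (2 * s).
Proof.
have s3 : 0 <= 32 * s ^+ 3 by rewrite mulr_ge0// exprn_ge0// ltW.
apply: (le_trans (normal_pdf_cube_le s0 x)); rewrite ler_wpM2l//.
by apply: normal_pdf_ub; rewrite mulf_neq0// gt_eqF.
Qed.

Let sqr_pdf_le (x : R) : `|x| ^+ 2 * normal_pdf 0 s x <=
  normal_peak s + 32 * s ^+ 3 * normal_peak (2 * s).
Proof.
have p0 := normal_pdf_ge0 0 s x.
have := sqr_le_cube x; rewrite normrX mul1r => H.
apply: (le_trans (ler_wpM2r p0 H)); rewrite mulrDl mul1r lerD//.
by apply: normal_pdf_ub; rewrite gt_eqF.
Qed.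

(** The integrand [x * pdf] is the derivative of [- s ^+ 2 * pdf], which vanishes
    at both ends. *)
Lemma normal_prob_mean : (\int[N]_x x%:E = 0)%E.
Proof.
rewrite integral_normal_prob//.
have dF (x : R) : is_derive x 1 (fun x => - s ^+ 2 * normal_pdf 0 s x) (x * normal_pdf 0 s x).
  have H := is_derive_normal_pdf x.
  apply: is_derive_eq; rewrite /GRing.scale/= ?mulr0 ?addr0.
  by field; rewrite gt_eqF.
have [|t1 t2] := @cvg_tail (fun x => - s ^+ 2 * normal_pdf 0 s x)
  (s ^+ 2 * (normal_peak s + 32 * s ^+ 3 * normal_peak (2 * s))).
  move=> x; rewrite normrM normrN (ger0_norm (sqr_ge0 _)).
  rewrite (ger0_norm (normal_pdf_ge0 _ _ _)) mulrCA ler_wpM2l ?sqr_ge0//.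
apply: integral_derivative0 dF _ t1 t2.
  move=> x; apply: cvgM; first exact: cvg_id.
  by apply: continuous_normal_pdf; rewrite gt_eqF.
exact: (integrable_cube_normal_pdf (a := 1) _ abs_le_cube).
Qed.

(** The function [(x ^+ 2 - s ^+ 2) * pdf] is the derivative of
    [- s ^+ 2 * x * pdf], which vanishes at both ends. *)
Lemma normal_prob_variance : (\int[N]_x (x ^+ 2)%:E = (s ^+ 2)%:E)%E.
Proof.
rewrite integral_normal_prob//.
have dF (x : R) : is_derive x 1 (fun x => - s ^+ 2 * (x * normal_pdf 0 s x))
    (x ^+ 2 * normal_pdf 0 s x - s ^+ 2 * normal_pdf 0 s x).
  have H := is_derive_normal_pdf x.
  apply: is_derive_eq; rewrite /GRing.scale/= ?mulr0 ?addr0 ?mulr1.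
  by field; rewrite gt_eqF.
have [|t1 t2] := @cvg_tail (fun x => - s ^+ 2 * (x * normal_pdf 0 s x))
  (s ^+ 2 * (32 * s ^+ 3 * normal_peak (2 * s))).
  move=> x; rewrite normrM normrN (ger0_norm (sqr_ge0 _)) normrM.
  rewrite (ger0_norm (normal_pdf_ge0 _ _ _)) mulrCA ler_wpM2l ?sqr_ge0//.
  by rewrite mulrA -exprSr; exact: cube_pdf_le.
have i1 : mu.-integrable [set: R] (fun x => (x ^+ 2 * normal_pdf 0 s x)%:E).
  by apply: (integrable_cube_normal_pdf (a := 1) _ sqr_le_cube); exact: measurable_funX.
have i2 : mu.-integrable [set: R] (fun x => (s ^+ 2 * normal_pdf 0 s x)%:E).
  under eq_fun do rewrite EFinM.
  by apply: integrableZl => //; exact: integrable_normal_pdf.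
have cp : continuous (normal_pdf 0 s) by apply: continuous_normal_pdf; rewrite gt_eqF.
have cf : continuous (fun x : R => x ^+ 2 * normal_pdf 0 s x - s ^+ 2 * normal_pdf 0 s x).
  move=> x; apply: cvgB.
    by apply: cvgM; [exact: exprn_continuous|exact: cp].
  by apply: cvgM; [exact: cvg_cst|exact: cp].
have := integral_derivative0 cf dF (integrableB measurableT i1 i2) t1 t2.
under eq_integral do rewrite EFinB.
rewrite integralB_EFin//.
have -> : (\int[mu]_x (s ^+ 2 * normal_pdf 0 s x)%:E = (s ^+ 2)%:E)%E.
  under eq_integral do rewrite EFinM.
  rewrite integralZl//; last exact: integrable_normal_pdf.
  by rewrite integral_normal_pdf mule1.
move=> /eqP; rewrite sube_eq ?add0e ?fin_num_adde_defl//; last first.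
  exact: integrable_fin_num i1.
by move=> /eqP.
Qed.

Lemma normal_prob_abs3 : (\int[N]_x (`|x| ^+ 3)%:E <= (32 * s ^+ 3)%:E)%E.
Proof.
have mc : measurable_fun [set: R] (fun x : R => `|x| ^+ 3).
  by apply: measurable_funX; exact: normr_measurable.
rewrite ge0_integral_normal_prob//.
have s3 : 0 <= 32 * s ^+ 3 by rewrite mulr_ge0// exprn_ge0// ltW.
apply: (@le_trans _ _ (\int[mu]_x ((32 * s ^+ 3)%:E * (normal_pdf 0 (2 * s) x)%:E))%E).
  apply: ge0_le_integral => //.
  - by move=> x _; rewrite lee_fin mulr_ge0 ?exprn_ge0 ?normal_pdf_ge0.
  - apply/measurable_EFinP; apply: measurable_funM; last exact: measurable_normal_pdf.
    exact: mc.
  - apply/measurable_EFinP; apply: measurable_funM => //; exact: measurable_normal_pdf.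
  - by move=> x _; rewrite -EFinM lee_fin normal_pdf_cube_le.
rewrite integralZl//; last exact: integrable_normal_pdf.
by rewrite integral_normal_pdf mule1.
Qed.

End normal_moments_values.

(** * One step of the discretised Markov process *)

Section chain_step.
Variables (R : realType) (m s : R).
Hypothesis m0 : 0 < m.

(** For $y_t=e^{2(sB_t-ms^2t)}$ with a Brownian motion $B$ and
    $A_t=\int_0^ty_u\,du$, the ratio $(r_0-2s^2A_t)/y_t$ is a Markov process. This
    is one step of its Euler scheme: the time step is [t ^+ 2], so that [t] is
    the standard deviation of the increment of $-B$ inserted for [v]. *)
Definition chain_step (t r v : R) : R :=
  (r - 2 * s ^+ 2 * t ^+ 2) * expR (2 * (m * s ^+ 2) * t ^+ 2 + 2 * s * v).

Definition step_bound : R :=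
  (log_cum_bound m * (2 * (m * s ^+ 2)) ^+ 2 +
   2 * s ^+ 2 * (log_cum_bound m * (2 * (m * s ^+ 2))) +
   invgamma_dfun_bound m * (2 * s ^+ 2) ^+ 2) +
  log_cum_bound m * (2 * `|s|) ^+ 3 * 32.

Lemma invgamma_dfun_bound_ge0 : 0 <= invgamma_dfun_bound m.
Proof. exact: le_trans (invgamma_dfun_le 0 m0). Qed.

Lemma log_cum_bound_ge0 : 0 <= log_cum_bound m.
Proof. exact: le_trans (log_cum2_le m0 0). Qed.

Lemma step_bound_ge0 : 0 <= step_bound.
Proof.
have d0 := invgamma_dfun_bound_ge0; have l0 := log_cum_bound_ge0.
have ms : 0 <= 2 * (m * s ^+ 2).
  by apply: mulr_ge0 => //; apply: mulr_ge0; [exact: ltW|exact: sqr_ge0].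
have s2 : 0 <= 2 * s ^+ 2 by apply: mulr_ge0 => //; exact: sqr_ge0.
apply: addr_ge0; first (apply: addr_ge0; first apply: addr_ge0).
- by apply: mulr_ge0 => //; exact: sqr_ge0.
- by apply: mulr_ge0 => //; apply: mulr_ge0.
- by apply: mulr_ge0 => //; exact: sqr_ge0.
- by apply: mulr_ge0 => //; apply: mulr_ge0 => //; apply: exprn_ge0; apply: mulr_ge0.
Qed.

Lemma cum_chain_step0 t r v : r <= 2 * s ^+ 2 * t ^+ 2 -> invgamma_cum m (chain_step t r v) = 0.
Proof.
move=> rt; rewrite invgamma_cum_neg// /chain_step mulr_le0_ge0 ?expR_ge0//.
by rewrite subr_le0.
Qed.

Lemma invgamma_cum_small (e r : R) : 0 <= e -> r <= e ->
  invgamma_cum m r <= invgamma_dfun_bound m * e ^+ 2.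
Proof.
move=> e0 re; have d0 := invgamma_dfun_bound_ge0.
have [r0|r0] := leP r 0.
  by rewrite invgamma_cum_neg// mulr_ge0// sqr_ge0.
have := taylor1 0 r (fun x => is_derive_invgamma_cum x m0)
   (fun x => is_derive_invgamma_fun x m0) (fun x => invgamma_dfun_le x m0).
rewrite add0r invgamma_fun_neg// mul0r (invgamma_cum_neg m (lexx 0)) !subr0 => H.
apply: (le_trans (ler_norm _)); apply: (le_trans H).
by rewrite ler_wpM2l// ler_sqr ?nnegrE// ltW.
Qed.

(** Taylor's formula of order two in the logarithm, whose first two Gaussian
    moments are explicit and whose remainder is of order [t ^+ 3], reduces the
    claim to [drift_shift_balance]. *)
Lemma chain_step_invariance (t r : R) : 0 < t <= 1 ->
  exists2 e : R, (\int[normal_prob 0 t]_v (invgamma_cum m (chain_step t r v))%:E = e%:E)%E &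
    `|e - invgamma_cum m r| <= step_bound * t ^+ 3.
Proof.
move=> /andP[t0 t1].
have t43 : t ^+ 4 <= t ^+ 3 by rewrite ler_wiXn2l// ltW.
have t30 : 0 <= t ^+ 3 by rewrite exprn_ge0// ltW.
have d0 := invgamma_dfun_bound_ge0; have l0 := log_cum_bound_ge0.
have ms : 0 <= 2 * (m * s ^+ 2).
  by apply: mulr_ge0 => //; apply: mulr_ge0; [exact: ltW|exact: sqr_ge0].
have s2 : 0 <= 2 * s ^+ 2 by apply: mulr_ge0 => //; exact: sqr_ge0.
set D0 := log_cum_bound m * (2 * (m * s ^+ 2)) ^+ 2 +
   2 * s ^+ 2 * (log_cum_bound m * (2 * (m * s ^+ 2))).
have D00 : 0 <= D0.
  by apply: addr_ge0; apply: mulr_ge0 => //; [exact: sqr_ge0|apply: mulr_ge0].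
set D2 := log_cum_bound m * (2 * `|s|) ^+ 3.
have D20 : 0 <= D2 by apply: mulr_ge0 => //; apply: exprn_ge0; apply: mulr_ge0.
have D10 : 0 <= invgamma_dfun_bound m * (2 * s ^+ 2) ^+ 2 by rewrite mulr_ge0// sqr_ge0.
have [rt|rt] := leP r (2 * s ^+ 2 * t ^+ 2).
  exists 0.
    by under eq_integral do rewrite cum_chain_step0//; rewrite integral0.
  rewrite sub0r normrN ger0_norm ?invgamma_cum_ge0//.
  have := invgamma_cum_small _ rt; rewrite mulr_ge0 ?sqr_ge0// => /(_ isT).
  move=> /le_trans; apply.
  rewrite exprMn -exprM mulrA (le_trans (ler_wpM2l D10 t43))//.
  rewrite ler_wpM2r// /step_bound -/D0 -/D2.
  have : 0 <= D2 * 32 by rewrite mulr_ge0.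
  lra.
pose p := r - 2 * s ^+ 2 * t ^+ 2.
have p0 : 0 < p by rewrite subr_gt0.
have h0 : 0 <= t ^+ 2 by rewrite sqr_ge0.
have := drift_shift_balance m0 s p0 h0 => /=.
have -> : p + 2 * s ^+ 2 * t ^+ 2 = r by rewrite subrK.
set x := ln p + _ => B1.
have FE v : invgamma_cum m (chain_step t r v) = log_cum0 m (x + 2 * s * v).
  by rewrite log_cum0E /chain_step /x -addrA [in RHS]expRD lnK.
pose F v := log_cum0 m (x + 2 * s * v).
pose q v := log_cum0 m x + (log_cum1 m x * (2 * s)) * v + (log_cum2 m x * (2 * s ^+ 2)) * v ^+ 2.
have Fq v : `|F v - q v| <= D2 * `|v| ^+ 3.
  have -> : F v - q v = log_cum0 m (x + 2 * s * v) - log_cum0 m x -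
      log_cum1 m x * (2 * s * v) - log_cum2 m x * (2 * s * v) ^+ 2 / 2.
    rewrite /F /q; move: (log_cum0 m (x + _)) (log_cum0 m x) (log_cum1 m x) (log_cum2 m x).
    by move=> y y0 y1 y2; field.
  have T := taylor2 x (2 * s * v) (is_derive_log_cum0 m0) (is_derive_log_cum1 m)
    (is_derive_log_cum2 m) (log_cum3_le m0).
  move: T; rewrite [in leRHS]normrM [in leRHS]normrM (ger0_norm (ler0n _ 2)).
  rewrite [in leRHS]exprMn [leRHS]mulrA -/D2; exact.
have mF : measurable_fun [set: R] F.
  apply: continuous_measurable_fun => v.
  apply: (cvg_comp (fun v => x + 2 * s * v)); last first.
    exact: (is_derive_continuous (is_derive_log_cum0 m0)).
  by apply: cvgD; [exact: cvg_cst|apply: cvgM; [exact: cvg_cst|exact: cvg_id]].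
have iF : (normal_prob 0 t).-integrable [set: R] (EFin \o F).
  apply: (@integrable_cube_normal_prob _ _ t0 _ (invgamma_mass m)) => // v.
  rewrite ger0_norm ?invgamma_cum_ge0//.
  apply: (le_trans (invgamma_cum_le_mass _ m0)).
  by rewrite ler_peMr ?lerDl ?exprn_ge0//; exact/ltW/invgamma_mass_gt0.
have i1 : (normal_prob 0 t).-integrable [set: R] (fun v : R => v%:E).
  exact: (integrable_cube_normal_prob t0 (a := 1) _ (@abs_le_cube R)).
have i2 : (normal_prob 0 t).-integrable [set: R] (fun v : R => (v ^+ 2)%:E).
  by apply: (integrable_cube_normal_prob t0 (a := 1) _ (@sqr_le_cube R)).
have ic : (normal_prob 0 t).-integrable [set: R] (fun v : R => (log_cum0 m x)%:E).
  exact: finite_measure_integrable_cst.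
have i1' : (normal_prob 0 t).-integrable [set: R] (fun v : R => (log_cum1 m x * (2 * s) * v)%:E).
  by under eq_fun do rewrite EFinM; exact: integrableZl.
have i2' : (normal_prob 0 t).-integrable [set: R] (fun v : R => (log_cum2 m x * (2 * s ^+ 2) * v ^+ 2)%:E).
  by under eq_fun do rewrite EFinM; exact: integrableZl.
have J1 : (\int[normal_prob 0 t]_v (log_cum1 m x * (2 * s) * v)%:E = 0)%E.
  by under eq_integral do rewrite EFinM; rewrite integralZl// normal_prob_mean// mule0.
have J2 : (\int[normal_prob 0 t]_v (log_cum2 m x * (2 * s ^+ 2) * v ^+ 2)%:E =
    (log_cum2 m x * (2 * s ^+ 2) * t ^+ 2)%:E)%E.
  by under eq_integral do rewrite EFinM; rewrite integralZl// normal_prob_variance// -EFinM.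
have iq : (normal_prob 0 t).-integrable [set: R] (fun v : R => (q v)%:E).
  rewrite /q; under eq_fun do rewrite !EFinD.
  by apply: integrableD => //; apply: integrableD.
have Iq : (\int[normal_prob 0 t]_v (q v)%:E)%E =
    (log_cum0 m x + 2 * s ^+ 2 * t ^+ 2 * log_cum2 m x)%:E.
  rewrite /q; under eq_integral do rewrite !EFinD.
  rewrite integralD//; last exact: integrableD.
  rewrite integralD//.
  rewrite J1 J2 adde0 integral_cst//= [X in (_ * X)%E](_ : _ = 1%E).
    by rewrite mule1 -EFinD; congr EFin; ring.
  exact: probability_setT.
have [e eE] : exists e : R, (\int[normal_prob 0 t]_v (F v)%:E)%E = e%:E.
  exists (fine (\int[normal_prob 0 t]_v (F v)%:E)%E).
  exact: (esym (fineK (integrable_fin_num measurableT iF))).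
exists e; first by rewrite -eE; apply: eq_integral => v _; rewrite FE.
set b := log_cum0 m x + 2 * s ^+ 2 * t ^+ 2 * log_cum2 m x in B1 Iq *.
have iFq := integrableB measurableT iF iq.
have B2 : `|e - b| <= D2 * 32 * t ^+ 3.
  rewrite -lee_fin (_ : (`|e - b|)%:E = `| \int[normal_prob 0 t]_v ((F v)%:E - (q v)%:E) |%E); last first.
    by rewrite (integralB_EFin measurableT iF iq) eE Iq.
  apply: (le_trans (le_abse_integral _ measurableT (measurable_int _ iFq))).
  have m3 : measurable_fun [set: R] (fun v : R => `|v| ^+ 3).
    by apply: measurable_funX; exact: normr_measurable.
  apply: (@le_trans _ _ (\int[normal_prob 0 t]_v (D2%:E * (`|v| ^+ 3)%:E))%E).
    apply: ge0_le_integral; first exact: measurableT.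
    - by move=> v _; exact: abse_ge0.
    - exact: (measurableT_comp (@abse_measurable R _) (measurable_int _ iFq)).
    - by apply/measurable_EFinP; exact: (measurable_funM (measurable_cst _) m3).
    - by move=> v _; rewrite -EFinB abse_EFin -EFinM lee_fin; exact: Fq.
  rewrite ge0_integralZl; [|exact: measurableT|exact/measurable_EFinP|by move=> v _; rewrite lee_fin exprn_ge0|by rewrite lee_fin].
  rewrite -(mulrA D2) [leRHS]EFinM; apply: lee_pmul; rewrite ?lee_fin//.
    by apply: integral_ge0 => v _; rewrite lee_fin exprn_ge0.
  exact: normal_prob_abs3.
rewrite (_ : e - _ = (e - b) - (invgamma_cum m r - b)); last by ring.
apply: (le_trans (ler_normB _ _)); apply: (le_trans (lerD B2 B1)).
rewrite -exprM -/D0 /step_bound -/D0 -/D2.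
have : 0 <= D0 + invgamma_dfun_bound m * (2 * s ^+ 2) ^+ 2 by rewrite addr_ge0.
move=> D; have := ler_wpM2l D t43; lra.
Qed.

End chain_step.

(** * Independence *)

Section independence.
Context (d d1 d2 : measure_display) (Omega : measurableType d)
  (T1 : measurableType d1) (T2 : measurableType d2) (R : realType).
Variable P : probability Omega R.
Variables (X : Omega -> T1) (Y : Omega -> T2).
Hypotheses (mX : measurable_fun [set: Omega] X) (mY : measurable_fun [set: Omega] Y).
Local Open Scope ereal_scope.

Let mXY : measurable_fun [set: Omega] (fun w => (X w, Y w)).
Proof. exact: measurable_fun_pair. Qed.

Let XY : {mfun Omega >-> (T1 * T2)%type} := mfun_Sub (mem_set mXY).

(** Independence of the pair [(X, Y)] from an event can be tested on
    rectangles, because these form a pi-system generating the product. *)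
Lemma independent_pair (E : set Omega) : measurable E ->
  (forall A B, measurable A -> measurable B ->
    P (X @^-1` A `&` Y @^-1` B `&` E) = P (X @^-1` A `&` Y @^-1` B) * P E) ->
  forall D : set (T1 * T2), measurable D ->
    P ((fun w => (X w, Y w)) @^-1` D `&` E) = P ((fun w => (X w, Y w)) @^-1` D) * P E.
Proof.
move=> mE H D mD.
have pE0 : (0 <= fine (P E))%R by rewrite fine_ge0.
pose m1 : {measure set (T1 * T2) -> \bar R} := pushforward (mrestr P mE) XY.
pose m2 : {measure set (T1 * T2) -> \bar R} := mscale (NngNum pE0) (distribution P XY).
have PE : (fine (P E))%:E = P E by rewrite fineK// fin_num_measure.
suff -> : P ((fun w => (X w, Y w)) @^-1` D `&` E) = m2 D by rewrite /m2/= /mscale/= PE muleC.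
apply: (@measure_unique _ R (T1 * T2)%type
  [set A `*` B | A in measurable & B in measurable] (fun=> setT) _ _ _ _ (m1 mXY) m2) => //.
- by rewrite measurable_prod_measurableType.
- move=> _ _ [A mA [B mB <-]] [A' mA' [B' mB' <-]].
  rewrite -setXI; exists (A `&` A'); first exact: measurableI.
  by exists (B `&` B') => //; exact: measurableI.
- by move=> n; exists setT => //; exists setT => //; rewrite setXTT.
- by rewrite bigcup_const.
- move=> _ [A mA [B mB <-]].
  rewrite /m2/= /mscale/= PE /m1/= /pushforward/= /mrestr.
  have -> : XY @^-1` (A `*` B) = X @^-1` A `&` Y @^-1` B by [].
  by rewrite H// muleC.
- move=> n; rewrite /m1/= /pushforward /mrestr.
  by rewrite preimage_setT setTI (le_lt_trans (probability_le1 _ _)) ?ltry.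
Qed.

Lemma ge0_integral_independent (nu : probability T2 R) (f : T1 * T2 -> \bar R) :
  (forall A B, measurable A -> measurable B ->
    P (X @^-1` A `&` Y @^-1` B) = P (X @^-1` A) * nu B) ->
  measurable_fun [set: T1 * T2] f -> (forall z, 0 <= f z) ->
  \int[P]_w f (X w, Y w) = \int[P]_w (\int[nu]_y f (X w, y)).
Proof.
move=> H mf f0.
pose X' : {mfun Omega >-> T1} := mfun_Sub (mem_set mX).
transitivity (\int[distribution P XY]_z f z).
  by rewrite ge0_integral_distribution.
transitivity (\int[distribution P X' \x nu]_z f z).
  apply: eq_measure_integral => D mD _; apply/esym.
  by apply: product_measure_unique => // A B mA mB; rewrite -H.
rewrite fubini_tonelli1// ge0_integral_distribution//.
- exact: measurable_fun_fubini_tonelli_F.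
- by move=> y; apply: integral_ge0.
Qed.

End independence.

(** * The chain driven by independent Gaussian increments *)

Section chain.
Context (d : measure_display) (Omega : measurableType d) (R : realType).
Variable P : probability Omega R.
Variables (m s t : R).
Hypotheses (m0 : 0 < m) (t01 : 0 < t <= 1).
Variable V : nat -> {mfun Omega >-> R}.
Hypothesis lawV : forall k A, measurable A -> P (V k @^-1` A) = normal_prob 0 t A.
Hypothesis indepV : forall n (A : nat -> set R), (forall i, measurable (A i)) ->
  P (\bigcap_(i < n) (V i @^-1` A i)) = (\prod_(i < n) P (V i @^-1` A i))%E.

Fixpoint chain (r0 : R) (k : nat) (w : Omega) : R :=
  if k is k'.+1 then chain_step m s t (chain r0 k' w) (V k' w) else r0.

Lemma measurable_chain_step :
  measurable_fun [set: R * R] (fun z : R * R => chain_step m s t z.1 z.2).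
Proof.
apply: measurable_funM.
  by apply: measurable_funB => //; exact: measurable_fst.
apply: measurableT_comp => //; apply: measurable_funD => //.
by apply: measurable_funM => //; exact: measurable_snd.
Qed.

Lemma measurable_chain r0 k : measurable_fun [set: Omega] (chain r0 k).
Proof.
elim: k => [|k IH]; first exact: measurable_cst.
rewrite (_ : chain r0 k.+1 = (fun z : R * R => chain_step m s t z.1 z.2) \o
  (fun w => (chain r0 k w, V k w)))//.
by apply: measurableT_comp; [exact: measurable_chain_step|exact: measurable_fun_pair].
Qed.

Let mchain r0 k : {mfun Omega >-> R} := mfun_Sub (mem_set (@measurable_chain r0 k)).

Lemma bigcap_ordS (F : nat -> set Omega) n :
  \bigcap_(i < n.+1) F i = F 0 `&` \bigcap_(i < n) F i.+1.
Proof. by rewrite !bigcap_mkord big_ord_recl. Qed.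

(** By induction on [k]: the next state is a function of the present state and
    of one increment, and this pair is independent of the later increments by
    [independent_pair]. *)
Lemma chain_independent r0 k n (A : set R) (B : nat -> set R) :
  measurable A -> (forall i, measurable (B i)) ->
  P (chain r0 k @^-1` A `&` \bigcap_(i < n) (V (k + i) @^-1` B i)) =
  (P (chain r0 k @^-1` A) * \prod_(i < n) P (V (k + i) @^-1` B i))%E.
Proof.
elim: k n A B => [|k IH] n A B mA mB.
  rewrite (_ : chain r0 0 = cst r0)// preimage_cst; case: ifPn => _.
    by rewrite setTI probability_setT mul1e indepV.
  by rewrite set0I measure0 mul0e.
pose B' (B0 : set R) i := if i is j.+1 then B j else B0.
have mB' B0 : measurable B0 -> forall i, measurable (B' B0 i) by move=> mB0 [|i] /=.
set E := \bigcap_(i < n) _.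
have EE B0 : \bigcap_(i < n.+1) (V (k + i) @^-1` B' B0 i) = V k @^-1` B0 `&` E.
  rewrite bigcap_ordS addn0; congr (_ `&` _).
  by apply: eq_bigcapr => i _; rewrite addSnnS.
have PE B0 : (\prod_(i < n.+1) P (V (k + i) @^-1` B' B0 i) =
    P (V k @^-1` B0) * \prod_(i < n) P (V (k.+1 + i) @^-1` B i))%E.
  rewrite big_ord_recl addn0; congr (_ * _)%E.
  by apply: eq_bigr => i _; rewrite addSnnS.
have PEE : P E = (\prod_(i < n) P (V (k.+1 + i) @^-1` B i))%E.
  have := IH n.+1 setT (B' setT) measurableT (mB' _ measurableT).
  by rewrite EE PE !preimage_setT !setTI probability_setT !mul1e.
have mE : measurable E by apply: bigcap_measurableType => i _; rewrite -[X in measurable X]setTI; exact: measurable_funPT.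
have rect1 A0 B0 : measurable A0 -> measurable B0 ->
    P (chain r0 k @^-1` A0 `&` V k @^-1` B0) = (P (chain r0 k @^-1` A0) * P (V k @^-1` B0))%E.
  move=> mA0 mB0; have := IH 1%N A0 (fun=> B0) mA0 (fun=> mB0).
  by rewrite bigcap_ordS big_ord_recl big_ord0 mule1 addn0 II0 bigcap_set0 setIT.
rewrite -PEE.
have -> : chain r0 k.+1 @^-1` A = (fun w => (chain r0 k w, V k w)) @^-1`
   ((fun z : R * R => chain_step m s t z.1 z.2) @^-1` A) by [].
apply: independent_pair => //; first exact: measurable_chain; last first.
  by rewrite -[X in measurable X]setTI; exact: measurable_chain_step.
move=> A0 B0 mA0 mB0; rewrite rect1// -setIA -EE IH//; last exact: mB'.
by rewrite PE PEE muleA.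
Qed.

Let cum_mass (r : R) : `|invgamma_cum m r| <= invgamma_mass m.
Proof. by rewrite ger0_norm ?invgamma_cum_ge0// invgamma_cum_le_mass. Qed.

Lemma integrable_invgamma_cum (X : Omega -> R) : measurable_fun [set: Omega] X ->
  P.-integrable [set: Omega] (fun w => (invgamma_cum m (X w))%:E).
Proof.
move=> mX; apply: (@le_integrable _ _ _ _ _ measurableT _ (fun=> (invgamma_mass m)%:E)).
- apply/measurable_EFinP; apply: measurableT_comp => //.
  by apply: continuous_measurable_fun; exact: continuous_invgamma_cum.
- by move=> w _; rewrite lee_fin (le_trans (cum_mass _))// ler_norm.
- exact: finite_measure_integrable_cst.
Qed.

(** Conditioning on the present state, by Fubini, leaves the estimate of
    [chain_step_invariance]. *)
Lemma chain_step_expectation r0 k :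
  `|\int[P]_w invgamma_cum m (chain r0 k.+1 w) - \int[P]_w invgamma_cum m (chain r0 k w)| <=
  step_bound m s * t ^+ 3.
Proof.
pose X := mchain r0 k.
have mcum : measurable_fun [set: R] (invgamma_cum m).
  by apply: continuous_measurable_fun; exact: continuous_invgamma_cum.
pose f (z : R * R) := (invgamma_cum m (chain_step m s t z.1 z.2))%:E.
have mf : measurable_fun [set: R * R] f.
  apply/measurable_EFinP; apply: (measurableT_comp mcum); exact: measurable_chain_step.
have f0 z : (0 <= f z)%E by rewrite lee_fin invgamma_cum_ge0.
pose G r := (\int[normal_prob 0 t]_y f (r, y))%E.
have mG : measurable_fun [set: R] G by exact: measurable_fun_fubini_tonelli_F.
have GP r : exists2 e : R, G r = e%:E & `|e - invgamma_cum m r| <= step_bound m s * t ^+ 3.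
  exact: chain_step_invariance.
have E1 : (\int[P]_w (invgamma_cum m (chain r0 k.+1 w))%:E = \int[P]_w G (X w))%E.
  have mVk : measurable_fun [set: Omega] (V k : Omega -> measurableTypeR R).
    have mVk' : measurable_fun [set: Omega] (V k) by [].
    exact: mVk'.
  apply: (ge0_integral_independent (P := P) (measurable_chain r0 k) mVk
    (nu := normal_prob 0 t) (f := f)) => //.
  move=> A B mA mB.
  have := @chain_independent r0 k 1 A (fun=> B) mA (fun=> mB).
  by rewrite bigcap_ordS big_ord_recl big_ord0 mule1 addn0 II0 bigcap_set0 setIT lawV.
have Gf r : G r = (fine (G r))%:E by have [e -> _] := GP r.
have mGX : measurable_fun [set: Omega] (fun w => G (X w)).
  exact: (measurableT_comp mG (measurable_chain r0 k)).
have mfG : measurable_fun [set: Omega] (fun w => fine (G (X w))).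
  exact: (measurableT_comp (fine_measurable measurableT) mGX).
have iG : P.-integrable [set: Omega] (fun w => (fine (G (X w)))%:E).
  apply: (@le_integrable _ _ _ _ _ measurableT _
    (fun=> (step_bound m s * t ^+ 3 + invgamma_mass m)%:E)).
  - exact/measurable_EFinP.
  - move=> w _; rewrite lee_fin; have [e -> /= He] := GP (X w).
    rewrite (le_trans _ (ler_norm _))// -(subrK (invgamma_cum m (X w)) e).
    by rewrite (le_trans (ler_normD _ _))// lerD.
  - exact: finite_measure_integrable_cst.
have E2 : (\int[P]_w G (X w) = \int[P]_w (fine (G (X w)))%:E)%E.
  by apply: eq_integral => w _; exact: Gf.
have R1 : \int[P]_w invgamma_cum m (chain r0 k.+1 w) = \int[P]_w fine (G (X w)).
  by rewrite /Rintegral E1 E2.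
have iX := integrable_invgamma_cum (measurable_chain r0 k).
have iD := integrableB measurableT iG iX.
rewrite R1 -(RintegralB measurableT iG iX).
apply: (le_trans (le_normr_Rintegral measurableT iD)).
have -> : step_bound m s * t ^+ 3 = \int[P]_w (step_bound m s * t ^+ 3).
  by rewrite Rintegral_cst//= probability_setT mulr1.
apply: le_Rintegral; first exact: measurableT.
- exact: (integrable_norm iD).
- exact: finite_measure_integrable_cst.
- by move=> w _; have [e -> /= He] := GP (X w).
Qed.

Lemma chain_expectation r0 n :
  `|\int[P]_w invgamma_cum m (chain r0 n w) - invgamma_cum m r0| <=
  n%:R * (step_bound m s * t ^+ 3).
Proof.
elim: n => [|n IH].
  by rewrite /= Rintegral_cst//= probability_setT mulr1 subrr normr0 mul0r.
rewrite -natr1 mulrDl mul1r [leRHS]addrC.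
set a := \int[P]_w _; set b := (X in _ <= X).
rewrite (_ : a - _ = (a - \int[P]_w invgamma_cum m (chain r0 n w)) +
  (\int[P]_w invgamma_cum m (chain r0 n w) - invgamma_cum m r0)); last by ring.
by rewrite (le_trans (ler_normD _ _))// lerD// chain_step_expectation.
Qed.

End chain.

(** * Riemann sums of continuous functions *)

Section riemann_sums.
Variable R : realType.
Notation mu := (@lebesgue_measure R).

(** Heine's theorem, by compactness of the segment. *)
Lemma uniform_continuity_segment (f : R -> R) (a b e : R) : continuous f -> 0 < e ->
  \forall t \near 0^'+, forall x y, x \in `[a, b] -> `|x - y| <= t -> `|f x - f y| <= e.
Proof.
move=> cf e0.
have /compact_near_coveringP := @segment_compact R a b.
move=> /(_ R (0^'+) (fun t x => forall y, `|x - y| <= t -> `|f x - f y| <= e)) H.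
have : \forall t \near 0^'+, [set` `[a, b]] `<=` (fun x => forall y, `|x - y| <= t -> `|f x - f y| <= e).
  apply: H => x _.
  have e2 : 0 < e / 2 by rewrite divr_gt0.
  have /cvgrPdist_le/(_ _ e2) := cf x.
  move=> /nbhs_ballP[r /= r0 xr].
  have r2 : 0 < r / 2 by rewrite divr_gt0.
  near=> x' t => /= y x'y.
  have xx' : `|x - x'| < r / 2 by near: x'; exact: (nbhsx_ballx x (r / 2) r2).
  have t2 : t < r / 2 by near: t; exact: nbhs_right_lt.
  have h1 : `|f x - f x'| <= e / 2.
    by apply: xr; rewrite /ball/= (lt_le_trans xx')//; lra.
  have h2 : `|f x - f y| <= e / 2.
    apply: xr; rewrite /ball/= -(subrK x' x) -addrA (le_lt_trans (ler_normD _ _))//.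
    by rewrite (splitr r) ltr_leD// (le_trans x'y) ?ltW.
  rewrite -(subrK (f x) (f x')) -addrA (le_trans (ler_normD _ _))//.
  by rewrite (splitr e) lerD// distrC.
apply: filterS => t tP x y xab; exact: tP.
Unshelve. all: by end_near. Qed.

Lemma continuous_integrable_itv (f : R -> R) (i : interval R) (a b : R) : continuous f ->
  [set` i] `<=` [set` `[a, b]] -> mu.-integrable [set` i] (EFin \o f).
Proof.
move=> cf iab; apply: (@integrableS _ _ _ mu [set` `[a, b]] [set` i]) => //; try exact: measurable_itv.
apply: continuous_compact_integrable; first exact: segment_compact.
exact: continuous_subspaceT.
Qed.

Lemma integral_increment (f : R -> R) (a b e : R) : continuous f -> 0 <= a -> a < b ->
  (forall x, a <= x <= b -> `|f x - f a| <= e) ->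
  `|(\int[mu]_(x in `[0, b]) f x - \int[mu]_(x in `[0, a]) f x) - (b - a) * f a| <= (b - a) * e.
Proof.
move=> cf a0 ab fe.
have b0 : 0 <= b by rewrite (le_trans a0) ?ltW.
have iab : mu.-integrable [set` `[0, b]] (EFin \o f).
  exact: (continuous_integrable_itv (a := 0) (b := b) cf).
rewrite (Rintegral_itvB iab) ?bnd_simp//; last exact: ltW.
have sab : [set` `]a, b]] `<=` [set` `[0, b]].
  by move=> x /=; rewrite !in_itv/= => /andP[ax ->]; rewrite (le_trans a0) ?ltW.
have i1 := continuous_integrable_itv cf sab.
have i2 c : mu.-integrable [set` `]a, b]] (EFin \o cst c).
  by apply: continuous_integrable_itv sab => x; exact: cvg_cst.
have M : fine (mu [set` `]a, b]]) = b - a by rewrite lebesgue_measure_itv/= lte_fin ab.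
have C c : \int[mu]_(x in `]a, b]) c = (b - a) * c by rewrite Rintegral_cst// M mulrC.
have iB : mu.-integrable [set` `]a, b]] (fun x => ((f x)%:E - (f a)%:E)%E).
  by apply: integrableB => //; exact: (i2 (f a)).
rewrite -(C (f a)) -RintegralB//; last exact: i2.
apply: (le_trans (le_normr_Rintegral _ _)) => //.
rewrite -(C e); apply: le_Rintegral => //.
- exact: integrable_norm iB.
- exact: i2.
- by move=> x /=; rewrite in_itv/= => /andP[ax xb]; apply: fe; rewrite xb ltW.
Qed.

Lemma riemann_sum_cvg (f : R -> R) (T : R) : continuous f -> 0 < T ->
  T / n.+1%:R * \sum_(j < n.+1) f (j%:R * (T / n.+1%:R)) @[n --> \oo] -->
  \int[mu]_(x in `[0, T]) f x.
Proof.
move=> cf T0; apply/cvgrPdist_le => e e0.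
have eT : 0 < e / T by rewrite divr_gt0.
have U := uniform_continuity_segment 0 T cf eT.
have c0 : T / n.+1%:R @[n --> \oo] --> (0:R).
  rewrite -(mulr0 T); apply: cvgM; first exact: cvg_cst.
  exact: (@cvg_harmonic R).
have : \forall n \near \oo, forall x y, x \in `[0, T] -> `|x - y| <= T / n.+1%:R -> `|f x - f y| <= e / T.
  move: U; rewrite near_withinE => /nbhs_ballP[r /= r0 rP].
  have /cvgrPdist_lt/(_ _ r0) := c0; apply: filterS => n /= nr.
  by apply: rP => //; rewrite divr_gt0.
apply: filterS => n H.
set h := T / n.+1%:R.
have h0 : 0 < h by rewrite divr_gt0.
have hT : n.+1%:R * h = T by rewrite /h mulrC divfK// pnatr_eq0.
pose I k := \int[mu]_(x in `[0, k%:R * h]) f x.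
have -> : \int[mu]_(x in `[0, T]) f x = \sum_(j < n.+1) (I j.+1 - I j).
  rewrite -(big_mkord xpredT (fun j => I j.+1 - I j)) telescope_sumr// /I hT mul0r.
  by rewrite set_itv1 Rintegral_set1 subr0.
rewrite mulr_sumr -sumrB (le_trans (ler_norm_sum _ _ _))//.
apply: (@le_trans _ _ (\sum_(j < n.+1) h * (e / T))); last first.
  by rewrite sumr_const card_ord -mulr_natl mulrA hT mulrC divfK// gt_eqF.
apply: ler_sum => j _.
have E : j.+1%:R * h - j%:R * h = h by rewrite -mulrBl -natrB// subSnn mul1r.
rewrite -/h; have -> : h * f (j%:R * h) = (j.+1%:R * h - j%:R * h) * f (j%:R * h).
  by rewrite E.
rewrite -[X in X * (e / T)]E; apply: integral_increment => //.
- by rewrite mulr_ge0// ltW.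
- by rewrite ltr_pM2r// ltr_nat.
- move=> x /andP[x1 x2]; apply: H.
    rewrite in_itv/=; apply/andP; split.
      by apply: le_trans x1; rewrite mulr_ge0// ltW.
    by apply: (le_trans x2); rewrite -hT ler_pM2r// ler_nat.
  by rewrite ger0_norm ?subr_ge0// -/h; lra.
Qed.

End riemann_sums.

(** * Backward geometric Brownian motion *)

Section brownian_functional.
Context (R : realType) (d : measure_display) (Omega : measurableType d).
Variables (P : probability Omega R) (W : R -> Omega -> R).
Hypothesis hW : two_sided_brownian_motion P W.
Variables (m s : R).
Hypothesis m0 : 0 < m.
Notation mu := (@lebesgue_measure R).

Let mW u : measurable_fun [set: Omega] (W u).
Proof. by case: hW. Qed.

Let cW w : continuous (fun u => W u w).
Proof. by case: hW. Qed.

(** Geometric Brownian motion run backwards from time $0$. Subtracting [W 0]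
    makes it start at $1$ for every path, whereas [W 0] vanishes only almost
    surely. *)
Definition backward_gbm (u : R) (w : Omega) : R :=
  expR (2 * (s * (W (- u) w - W 0 w) - m * s ^+ 2 * u)).

Lemma backward_gbm_gt0 u w : 0 < backward_gbm u w.
Proof. exact: expR_gt0. Qed.

Lemma continuous_backward_gbm w : continuous (fun u => backward_gbm u w).
Proof.
move=> u; apply: (cvg_comp _ expR); last exact: continuous_expR.
apply: cvgM; first exact: cvg_cst.
apply: cvgB.
  apply: cvgM; first exact: cvg_cst.
  apply: cvgB; last exact: cvg_cst.
  apply: (cvg_comp -%R (fun u => W u w)); last exact: cW.
  by apply: cvgN; exact: cvg_id.
by apply: cvgM; [exact: cvg_cst|exact: cvg_id].
Qed.

Lemma measurable_backward_gbm u : measurable_fun [set: Omega] (backward_gbm u).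
Proof.
apply: measurableT_comp => //; apply: measurable_funM => //.
apply: measurable_funB => //; apply: measurable_funM => //.
exact: measurable_funB.
Qed.

Definition gbm_integral (T : R) (w : Omega) : R :=
  \int[mu]_(u in `[0, T]) backward_gbm u w.

Lemma measurable_gbm_integral T : 0 < T -> measurable_fun [set: Omega] (gbm_integral T).
Proof.
move=> T0.
apply: (measurable_fun_cvg (h := fun n w => T / n.+1%:R *
    \sum_(j < n.+1) backward_gbm (j%:R * (T / n.+1%:R)) w)).
  move=> n; apply: measurable_funM => //; apply: measurable_sum => j.
  exact: measurable_backward_gbm.
by move=> w _; apply: riemann_sum_cvg => //; exact: continuous_backward_gbm.
Qed.

Let dW (h : R) (k : nat) (w : Omega) := W (- (k%:R * h)) w - W (- (k.+1%:R * h)) w.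

Let measurable_dW h k : measurable_fun [set: Omega] (dW h k).
Proof. exact: measurable_funB. Qed.

Let V h k : {mfun Omega >-> R} := mfun_Sub (mem_set (measurable_dW h k)).

Let lawV h k A : 0 < h -> measurable A -> P (V h k @^-1` A) = normal_prob 0 (Num.sqrt h) A.
Proof.
move=> h0 mA.
have lt : - (k.+1%:R * h) < - (k%:R * h) by rewrite ltrN2 ltr_pM2r// ltr_nat.
have E : - (k%:R * h) - - (k.+1%:R * h) = h.
  by rewrite opprK addrC -mulrBl -natrB// subSnn mul1r.
case: hW => _ _ _ law _.
by apply: (eq_trans (law _ _ lt A mA)); rewrite E.
Qed.

Let indepV h n (A : nat -> set R) : 0 < h -> (forall i, measurable (A i)) ->
  P (\bigcap_(i < n) (V h i @^-1` A i)) = (\prod_(i < n) P (V h i @^-1` A i))%E.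
Proof.
move=> h0 mA.
pose F (j : nat) := increment W ((j%:R - n%:R) * h) ((j.+1%:R - n%:R) * h) @^-1` A (n - j.+1)%N.
have FE (i : 'I_n) : F (rev_ord i) = V h i @^-1` A i.
  rewrite /F /= (_ : (n - (n - i.+1).+1)%N = i); last by rewrite subnSK// subKn// ltnW.
  have E : increment W (((n - i.+1)%:R - n%:R) * h) (((n - i.+1).+1%:R - n%:R) * h) = dW h i.
    apply/funext => w; rewrite /increment /dW; congr (W _ w - W _ w).
      by rewrite subnSK// natrB ?(ltnW (ltn_ord i))//; ring.
    by rewrite natrB//; ring.
  by rewrite E.
have H : P (\bigcap_(i < n) F i) = (\prod_(i < n) P (F i))%E.
  case: hW => _ _ _ _ /(_ n (fun j => (j%:R - n%:R) * h) (fun j => A (n - j.+1)%N)).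
  by apply => // i; rewrite ler_pM2r// lerD2r ler_nat.
have -> : \bigcap_(i < n) (V h i @^-1` A i) = \bigcap_(i < n) F i.
  rewrite !bigcap_mkord [RHS](reindex_inj rev_ord_inj).
  by apply: eq_bigr => i _; rewrite FE.
by rewrite H (reindex_inj rev_ord_inj); apply: eq_bigr => i _; rewrite FE.
Qed.

(** The chain is linear in its state, so it can be solved explicitly; a Riemann
    sum of the path appears. *)
Let chainE h r0 k w : 0 < h ->
  chain m s (Num.sqrt h) (V h) r0 k w =
  (r0 - 2 * s ^+ 2 * (h * \sum_(j < k) backward_gbm (j%:R * h) w)) / backward_gbm (k%:R * h) w.
Proof.
move=> h0; elim: k => [|k IH] /=.
  by rewrite big_ord0 mulr0 mulr0 subr0 mul0r /backward_gbm oppr0 subrr !mulr0 subr0 mulr0 expR0 divr1.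
rewrite /chain_step IH sqr_sqrtr ?ltW// big_ord_recr/=.
have -> : backward_gbm (k.+1%:R * h) w = backward_gbm (k%:R * h) w *
   expR (- (2 * (m * s ^+ 2) * h + 2 * s * dW h k w)).
  by rewrite /backward_gbm -expRD; congr expR; rewrite /dW -natr1; ring.
rewrite expRN; field; rewrite !gt_eqF ?expR_gt0//.
Qed.

(** Refining the time step, the Riemann sums converge pathwise and the
    expectations by dominated convergence, while the accumulated error of
    [n.+1] steps is of the order of the square root of the step. *)
Lemma cum_gbm_expectation (T r0 : R) : 0 < T ->
  \int[P]_w invgamma_cum m ((r0 - 2 * s ^+ 2 * gbm_integral T w) / backward_gbm T w) =
  invgamma_cum m r0.
Proof.
move=> T0.
pose h n : R := T / n.+1%:R.
have h0 n : 0 < h n by rewrite divr_gt0.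
have hT n : n.+1%:R * h n = T by rewrite /h mulrC divfK// pnatr_eq0.
have hc : h n @[n --> \oo] --> (0:R).
  rewrite -(mulr0 T); apply: cvgM; first exact: cvg_cst.
  exact: (@cvg_harmonic R).
pose X n w := chain m s (Num.sqrt (h n)) (V (h n)) r0 n.+1 w.
pose Y w := (r0 - 2 * s ^+ 2 * gbm_integral T w) / backward_gbm T w.
have XE n w : X n w = (r0 - 2 * s ^+ 2 * (h n * \sum_(j < n.+1) backward_gbm (j%:R * h n) w)) / backward_gbm T w.
  by rewrite /X chainE// hT.
have mcum : measurable_fun [set: R] (invgamma_cum m).
  by apply: continuous_measurable_fun; exact: continuous_invgamma_cum.
have mX n : measurable_fun [set: Omega] (X n) by exact: measurable_chain.
have XY w : X n w @[n --> \oo] --> Y w.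
  under eq_fun do rewrite XE.
  apply: cvgM; last exact: cvg_cst.
  apply: cvgB; first exact: cvg_cst.
  apply: cvgM; first exact: cvg_cst.
  by apply: riemann_sum_cvg => //; exact: continuous_backward_gbm.
have mY : measurable_fun [set: Omega] Y by apply: (measurable_fun_cvg (h := X)) => // w _; exact: XY.
have cXY w : (invgamma_cum m (X n w))%:E @[n --> \oo] --> (invgamma_cum m (Y w))%:E.
  apply: cvg_EFin; first exact: nearW.
  apply: (@continuous_cvg _ _ _ _ _ _ (invgamma_cum m)); last exact: XY.
  exact: continuous_invgamma_cum.
have fm (X' : Omega -> R) : measurable_fun [set: Omega] X' ->
  (\int[P]_w (invgamma_cum m (X' w))%:E)%E \is a fin_num.
  by move=> mX'; apply: (integrable_fin_num measurableT); exact: integrable_invgamma_cum.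
have DC : (\int[P]_w (invgamma_cum m (X n w))%:E)%E @[n --> \oo] -->
    (\int[P]_w (invgamma_cum m (Y w))%:E)%E.
  apply: (@dominated_cvg _ _ _ P _ measurableT _ _ (fun=> (invgamma_mass m)%:E)) => //.
  - by move=> n; apply/measurable_EFinP; exact: measurableT_comp.
  - exact: finite_measure_integrable_cst.
  - move=> n w _; rewrite lee_fin ger0_norm ?invgamma_cum_ge0//.
    exact: invgamma_cum_le_mass.
have {}DC : \int[P]_w invgamma_cum m (X n w) @[n --> \oo] --> \int[P]_w invgamma_cum m (Y w).
  by apply: fine_cvg; rewrite fineK ?fm.
have C0 := step_bound_ge0 s m0.
suff : \int[P]_w invgamma_cum m (X n w) @[n --> \oo] --> invgamma_cum m r0.
  by move=> /(cvg_unique _ DC) ->.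
apply/cvgrPdist_le => e e0.
pose K := T * step_bound m s.
have K0 : 0 <= K by rewrite mulr_ge0// ltW.
have K1 : 0 < K + 1 by rewrite ltr_wpDl.
have sc : Num.sqrt (h n) @[n --> \oo] --> (0 : R).
  by rewrite -(@sqrtr0 R); apply: continuous_cvg => //; exact: sqrt_continuous.
near=> n.
have hn1 : h n <= 1 by near: n; apply: (cvgr_le _ hc).
have hne : Num.sqrt (h n) <= e / (K + 1).
  by near: n; apply: (cvgr_le _ sc); rewrite divr_gt0.
have s01 : 0 < Num.sqrt (h n) <= 1 by rewrite sqrtr_gt0 h0/= -sqrtr1 ler_wsqrtr.
rewrite distrC.
have := @chain_expectation _ _ _ P m s _ m0 s01 (V (h n)) (fun k A => @lawV (h n) k A (h0 n))
  (fun k A => @indepV (h n) k A (h0 n)) r0 n.+1.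
move=> /le_trans; apply.
rewrite exprS sqr_sqrtr ?(ltW (h0 n))//.
have -> : n.+1%:R * (step_bound m s * (Num.sqrt (h n) * h n)) = K * Num.sqrt (h n).
  by rewrite /K -(hT n); ring.
apply: (le_trans (ler_wpM2l K0 hne)).
by rewrite mulrA ler_pdivrMr// mulrC ler_wpM2l ?ltW// ltrDl.
Unshelve. all: by end_near. Qed.

End brownian_functional.

(** * Dufresne's identity *)

Section normal_tail.
Variable R : realType.

Lemma normal_prob_tail (t a : R) : 0 < t -> 0 < a ->
  (normal_prob 0 t [set x | (a <= `|x|)%R] <= (t ^+ 2 / a ^+ 2)%:E)%E.
Proof.
move=> t0 a0; set A := [set x | _].
have mA : measurable A.
  rewrite (_ : A = (fun x : R => `|x|) @^-1` [set` `[a, +oo[]).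
    by rewrite -[X in measurable X]setTI; apply: normr_measurable => //.
  by apply/seteqP; split => x /=; rewrite in_itv/= andbT.
have -> : (normal_prob 0 t A = \int[normal_prob 0 t]_x (\1_A x)%:E)%E.
  by rewrite integral_indic// setIT.
have -> : ((t ^+ 2 / a ^+ 2)%:E = \int[normal_prob 0 t]_x (x ^+ 2 / a ^+ 2)%:E)%E.
  under eq_integral do rewrite mulrC EFinM.
  rewrite ge0_integralZl//.
  - by rewrite normal_prob_variance// -EFinM mulrC.
  - by apply/measurable_EFinP; exact: exprn_measurable.
  - by move=> x _; rewrite lee_fin sqr_ge0.
  - by rewrite lee_fin invr_ge0 sqr_ge0.
apply: ge0_le_integral => //.
- exact/measurable_EFinP/measurable_indic.
- by apply/measurable_EFinP; apply: measurable_funM => //; exact: exprn_measurable.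
- move=> x _; rewrite lee_fin indicE; case: (boolP (x \in A)) => [|_].
    rewrite inE/= /A/= => ax; rewrite ler_pdivlMr ?exprn_gt0// mul1r.
    by rewrite -(real_normK (num_real x)) ler_sqr ?nnegrE// ltW.
  by rewrite mulr_ge0 ?invr_ge0 ?sqr_ge0.
Qed.

End normal_tail.

Section law_of_total_integral.
Context (R : realType) (d : measure_display) (Omega : measurableType d).
Variables (P : probability Omega R) (W : R -> Omega -> R).
Hypothesis hW : two_sided_brownian_motion P W.
Variables (m s : R).
Hypotheses (m0 : 0 < m) (s0 : s != 0).
Notation mu := (@lebesgue_measure R).
Notation Y := (backward_gbm W m s).
Notation I := (gbm_integral W m s).

Definition gbm_total (w : Omega) : \bar R := (\int[mu]_(u in `[0%R, +oo[) (Y u w)%:E)%E.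

Let cY w : continuous (fun u => Y u w).
Proof. exact: (continuous_backward_gbm hW). Qed.

Let mY w : measurable_fun [set: R] (fun u => Y u w).
Proof. exact: continuous_measurable_fun. Qed.

Lemma gbm_integralE (T : R) w : (I T w)%:E = (\int[mu]_(u in `[0%R, T]) (Y u w)%:E)%E.
Proof.
rewrite /gbm_integral /Rintegral fineK//.
apply: (@integrable_fin_num _ _ _ mu [set` `[0, T]]) => //.
by apply: (@continuous_integrable_itv R (fun u => Y u w) _ 0 T (@cY w)).
Qed.

Lemma gbm_integral_cvg w : (I n%:R w)%:E @[n --> \oo] --> gbm_total w.
Proof.
under eq_fun do rewrite gbm_integralE.
apply: ge0_cvgn_integral => // u; exact/ltW/backward_gbm_gt0.
Qed.

Let subset_integral_Y (D1 D2 : set R) w : measurable D1 -> measurable D2 -> D1 `<=` D2 ->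
  (\int[mu]_(u in D1) (Y u w)%:E <= \int[mu]_(u in D2) (Y u w)%:E)%E.
Proof.
move=> mD1 mD2 D12; apply: ge0_subset_integral => //.
- by apply/measurable_EFinP; apply: measurable_funTS; exact: (@mY w).
- by move=> u _; rewrite lee_fin ltW// backward_gbm_gt0.
Qed.

Lemma gbm_integral_le_total (T : R) w : ((I T w)%:E <= gbm_total w)%E.
Proof.
rewrite gbm_integralE; apply: subset_integral_Y => //; try exact: measurable_itv.
by move=> u /=; rewrite !in_itv/= => /andP[->].
Qed.

Lemma gbm_integral_nd w (S T : R) : S <= T -> I S w <= I T w.
Proof.
move=> ST; rewrite -lee_fin !gbm_integralE.
apply: subset_integral_Y => //; try exact: measurable_itv.
by move=> u /=; rewrite !in_itv/= => /andP[-> /le_trans]; apply.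
Qed.

Lemma gbm_total_le (b : R) :
  [set w | (gbm_total w <= b%:E)%E] = \bigcap_n [set w | I n.+1%:R w <= b].
Proof.
apply/seteqP; split => w /= H.
  by move=> n _ /=; rewrite -lee_fin (le_trans (gbm_integral_le_total _ _)).
have := @gbm_integral_cvg w; apply: cvge_le.
by near=> n; rewrite lee_fin (le_trans (@gbm_integral_nd w n%:R n.+1%:R _))// ?ler_nat//; exact: H.
Unshelve. all: by end_near. Qed.

Let mI (n : nat) (b : R) : measurable [set w | I n.+1%:R w <= b].
Proof.
rewrite (_ : [set _ | _] = I n.+1%:R @^-1` [set` `]-oo, b]]).
  by rewrite -[X in measurable X]setTI; apply: (measurable_gbm_integral hW).
by apply/seteqP; split => w /=; rewrite in_itv.
Qed.

Lemma measurable_gbm_total_le (b : R) : measurable [set w | (gbm_total w <= b%:E)%E].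
Proof. by rewrite gbm_total_le; exact: bigcap_measurableType. Qed.

Lemma cvg_prob_gbm_integral (b : R) :
  P [set w | I n.+1%:R w <= b] @[n --> \oo] --> P [set w | (gbm_total w <= b%:E)%E].
Proof.
rewrite gbm_total_le; apply: nonincreasing_cvg_mu => //.
- by rewrite (le_lt_trans (probability_le1 _ _)) ?ltry.
- exact: bigcap_measurableType.
- move=> n k nk; apply/subsetPset => w /=; apply: le_trans.
  by apply: gbm_integral_nd; rewrite ler_nat.
Qed.

Lemma measurable_gbm_gt u (e : R) : measurable [set w | e < Y u w].
Proof.
rewrite (_ : [set _ | _] = Y u @^-1` [set` `]e, +oo[]).
  by rewrite -[X in measurable X]setTI; apply: (measurable_backward_gbm hW).
by apply/seteqP; split => w /=; rewrite in_itv/= andbT.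
Qed.

(** By Chebyshev's inequality the Brownian fluctuation is of smaller order than
    the drift, so the backward motion vanishes in probability. *)
Lemma prob_gbm_gt_cvg0 (e : R) : 0 < e ->
  P [set w | e < Y n.+1%:R w] @[n --> \oo] --> 0%E.
Proof.
move=> e0.
pose c := m * `|s| / 2.
have s1 : 0 < `|s| by rewrite normr_gt0.
have c0 : 0 < c by rewrite divr_gt0// mulr_gt0.
have s2 : m * s ^+ 2 = 2 * (c * `|s|).
  by rewrite /c -(real_normK (num_real s)); field.
apply: (@squeeze_cvge _ _ _ _ (cst 0%E) _ (fun n => (c ^- 2 * n.+1%:R^-1)%:E)); last 2 first.
- exact: cvg_cst.
- apply: cvg_EFin; first exact: nearW.
  rewrite -(mulr0 (c ^- 2)); apply: cvgM; first exact: cvg_cst.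
  exact: (@cvg_harmonic R).
near=> n; rewrite measure_ge0/=.
have n0 : (0 < n.+1%:R :> R) by rewrite ltr0n.
have a0 : 0 < c * n.+1%:R by rewrite mulr_gt0.
have nl : - ln e <= m * s ^+ 2 * n.+1%:R.
  rewrite -ler_pdivrMl; last by rewrite s2 !mulr_gt0.
  apply: (@le_trans _ _ n%:R); last by rewrite ler_nat.
  by near: n; exact: nbhs_infty_ger.
pose A : set R := [set x | c * n.+1%:R <= `|x|].
have mA : measurable A.
  rewrite (_ : A = (fun x : R => `|x|) @^-1` [set` `[c * n.+1%:R, +oo[]).
    by rewrite -[X in measurable X]setTI; apply: normr_measurable => //.
  by apply/seteqP; split => x /=; rewrite in_itv/= andbT.
have PA : (P (increment W (- n.+1%:R) 0 @^-1` A) <= (c ^- 2 * n.+1%:R^-1)%:E)%E.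
  have nn : - n.+1%:R < 0 :> R by rewrite ltrNl oppr0.
  case: hW => _ _ _ H _; rewrite (H _ _ nn A mA).
  rewrite sub0r opprK (le_trans (normal_prob_tail _ a0)) ?sqrtr_gt0//.
  rewrite lee_fin sqr_sqrtr ?ler0n// le_eqVlt; apply/orP; left; apply/eqP; field.
  by rewrite !gt_eqF.
apply: le_trans PA; apply: le_measure; rewrite ?inE.
- exact: measurable_gbm_gt.
- rewrite -[X in measurable X]setTI; have [mW _ _ _ _] := hW.
  by apply: measurable_funB.
move=> w; rewrite /= /increment /A/= /backward_gbm => H.
set B := W (- n.+1%:R) w - W 0 w in H *.
have {}H : ln e < 2 * (s * B - m * s ^+ 2 * n.+1%:R).
  by rewrite -(expRK (2 * _)) ltr_ln// posrE expR_gt0.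
rewrite -normrN opprB -/B.
have sB : s * B <= `|s| * `|B| by rewrite -normrM ler_norm.
rewrite -(ler_pM2l s1); move: H nl; rewrite s2; lra.
Unshelve. all: by end_near. Qed.

Let cum_gbm (b : R) n w :=
  invgamma_cum m ((2 * s ^+ 2 * b - 2 * s ^+ 2 * I n.+1%:R w) / Y n.+1%:R w).

Let measurable_cum_gbm b n : measurable_fun [set: Omega] (fun w =>
  (2 * s ^+ 2 * b - 2 * s ^+ 2 * I n.+1%:R w) / Y n.+1%:R w).
Proof.
apply: measurable_funM.
  apply: measurable_funB => //; apply: measurable_funM => //.
  exact: (measurable_gbm_integral hW).
rewrite (_ : (fun _ => _) = fun w => expR (- (2 * (s * (W (- n.+1%:R) w - W 0 w) - m * s ^+ 2 * n.+1%:R)))).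
  apply: measurableT_comp => //; apply: measurableT_comp => //.
  apply: measurable_funM => //; apply: measurable_funB => //; apply: measurable_funM => //.
  by have [mW _ _ _ _] := hW; exact: measurable_funB.
by apply/funext => w; rewrite /backward_gbm expRN.
Qed.

Let integral_cum_gbm b n :
  (\int[P]_w (cum_gbm b n w)%:E = (invgamma_cum m (2 * s ^+ 2 * b))%:E)%E.
Proof.
rewrite -(cum_gbm_expectation hW s m0 _ (T := n.+1%:R)) ?ltr0n//.
rewrite /Rintegral fineK//; apply: (integrable_fin_num measurableT).
by apply: integrable_invgamma_cum => //; exact: measurable_cum_gbm.
Qed.

Let mcum b n : measurable_fun [set: Omega] (fun w => (cum_gbm b n w)%:E).
Proof.
apply: (measurable_int P).
by apply: integrable_invgamma_cum => //; exact: measurable_cum_gbm.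
Qed.

(** If the integral up to time [n.+1] exceeds [b], the ratio is negative and the
    distribution function vanishes there. *)
Lemma cum_le_prob (b : R) : ((invgamma_cum m (2 * s ^+ 2 * b))%:E <=
  (invgamma_mass m)%:E * P [set w | (gbm_total w <= b%:E)%E])%E.
Proof.
have H : ((invgamma_mass m)%:E * P [set w | (I n.+1%:R w <= b)%R])%E @[n --> \oo] -->
    ((invgamma_mass m)%:E * P [set w | gbm_total w <= b%:E])%E.
  by apply: cvgeZl => //; exact: cvg_prob_gbm_integral.
move: H; apply: cvge_ge; apply: nearW => n.
rewrite -(integral_cum_gbm b n).
have -> : (P [set w | (I n.+1%:R w <= b)%R] = \int[P]_w (\1_[set w | (I n.+1%:R w <= b)%R] w)%:E)%E.
  by rewrite integral_indic// setIT.
rewrite -ge0_integralZl//; last 2 first.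
- exact/measurable_EFinP/measurable_indic.
- by rewrite lee_fin ltW// invgamma_mass_gt0.
apply: ge0_le_integral => //.
- by move=> w _; rewrite lee_fin invgamma_cum_ge0.
- by apply/measurable_EFinP; apply: measurable_funM => //; exact: measurable_indic.
- move=> w _; rewrite -EFinM lee_fin indicE; case: (boolP (w \in _)) => [_|].
    by rewrite mulr1 invgamma_cum_le_mass.
  rewrite notin_setE/= => /negP; rewrite -ltNge => bI.
  rewrite mulr0 /cum_gbm invgamma_cum_neg// mulr_le0_ge0//; last first.
    by rewrite invr_ge0 ltW// backward_gbm_gt0.
  by rewrite -mulrBr mulr_ge0_le0 ?subr_le0 ?(ltW bI)// mulr_ge0// sqr_ge0.
Qed.

(** If the integral up to time [n.+1] is at most [b] and the path is at most
    $2s^2e/x$, the ratio started from [2 * s ^+ 2 * (b + e)] is at least [x]. The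
    event that the path is larger is negligible as [n] grows. *)
Lemma prob_le_cum (b e x : R) : 0 < e -> 0 < x ->
  ((invgamma_cum m x)%:E * P [set w | (gbm_total w <= b%:E)%E] <=
   (invgamma_cum m (2 * s ^+ 2 * (b + e)))%:E)%E.
Proof.
move=> e0 x0.
have s2 : 0 < 2 * s ^+ 2 by rewrite mulr_gt0// exprn_even_gt0.
pose q := 2 * s ^+ 2 * e / x.
have q0 : 0 < q by rewrite divr_gt0// mulr_gt0.
have c0 : 0 <= invgamma_cum m x by exact: invgamma_cum_ge0.
have H1 : ((invgamma_cum m x)%:E * P [set w | (I n.+1%:R w <= b)%R])%E @[n --> \oo] -->
    ((invgamma_cum m x)%:E * P [set w | gbm_total w <= b%:E])%E.
  by apply: cvgeZl => //; exact: cvg_prob_gbm_integral.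
have H2 : ((invgamma_cum m (2 * s ^+ 2 * (b + e)))%:E +
   (invgamma_cum m x)%:E * P [set w | (q < Y n.+1%:R w)%R])%E @[n --> \oo] -->
   (invgamma_cum m (2 * s ^+ 2 * (b + e)))%:E.
  rewrite -[X in _ --> X]adde0; apply: cvgeD => //; first exact: cvg_cst.
  rewrite -(mule0 (invgamma_cum m x)%:E); apply: cvgeZl => //.
  exact: prob_gbm_gt_cvg0.
rewrite -(cvg_lim _ H1)// -(cvg_lim _ H2)//; apply: lee_lim.
- by apply/cvg_ex; eexists; exact: H1.
- by apply/cvg_ex; eexists; exact: H2.
apply: nearW => n.
have mA := mI n b; have mB := measurable_gbm_gt n.+1%:R q.
have -> : (P [set w | (I n.+1%:R w <= b)%R] = \int[P]_w (\1_[set w | (I n.+1%:R w <= b)%R] w)%:E)%E.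
  by rewrite integral_indic// setIT.
have -> : (P [set w | (q < Y n.+1%:R w)%R] = \int[P]_w (\1_[set w | (q < Y n.+1%:R w)%R] w)%:E)%E.
  by rewrite integral_indic// setIT.
rewrite -(integral_cum_gbm (b + e) n).
rewrite -!ge0_integralZl//; try exact/measurable_EFinP/measurable_indic.
rewrite -ge0_integralD//; last 3 first.
- by move=> w _; rewrite lee_fin invgamma_cum_ge0.
- by move=> w _; rewrite -EFinM lee_fin mulr_ge0.
- by apply/measurable_EFinP; apply: measurable_funM => //; exact: measurable_indic.
apply: ge0_le_integral => //.
- by move=> w _; rewrite -EFinM lee_fin mulr_ge0.
- by apply/measurable_EFinP; apply: measurable_funM => //; exact: measurable_indic.
- apply: emeasurable_funD => //.
  by apply/measurable_EFinP; apply: measurable_funM => //; exact: measurable_indic.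
- move=> w _; rewrite -!EFinM -EFinD lee_fin !indicE.
  have g0 : 0 <= cum_gbm (b + e) n w by exact: invgamma_cum_ge0.
  case: (boolP (w \in [set w | q < Y n.+1%:R w])) => [_|].
    by rewrite mulr1 ler_wpDl// ler_piMr// lern1; case: (w \in _).
  rewrite notin_setE/= => /negP; rewrite -leNgt => Yq.
  rewrite mulr0 addr0; case: (boolP (w \in _)) => [|_]; last by rewrite mulr0.
  rewrite inE/= mulr1 => Ib; apply: nondecreasing_invgamma_cum => //.
  have Y0 := backward_gbm_gt0 W m s n.+1%:R w.
  rewrite ler_pdivlMr// -mulrBr (@le_trans _ _ (x * q))//.
    by rewrite ler_wpM2l// ltW.
  by rewrite /q mulrC divfK ?gt_eqF// ler_pM2l//; lra.
Qed.

(** Dufresne's identity. In [prob_le_cum] the level [x] may tend to infinity,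
    because the path vanishes in probability, and [e] may tend to $0$, because
    the distribution function is continuous; [cum_le_prob] is the reverse
    inequality. *)
Theorem gbm_total_law (b : R) :
  P [set w | (gbm_total w <= b%:E)%E] =
  (invgamma_cum m (2 * s ^+ 2 * b) / invgamma_mass m)%:E.
Proof.
have M0 := invgamma_mass_gt0 m0.
have mE := measurable_gbm_total_le b.
pose p := fine (P [set w | (gbm_total w <= b%:E)%E]).
have pE : P [set w | (gbm_total w <= b%:E)%E] = p%:E by rewrite fineK// fin_num_measure.
rewrite pE; congr EFin; apply: (mulIf (lt0r_neq0 M0)).
rewrite (divfK (lt0r_neq0 M0)); apply/eqP; rewrite eq_le andbC; apply/andP; split.
  by have := cum_le_prob b; rewrite pE -EFinM lee_fin (mulrC _ p).
have H x e : 0 < e -> 0 < x -> invgamma_cum m x * p <= invgamma_cum m (2 * s ^+ 2 * (b + e)).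
  by move=> e0 x0; have := prob_le_cum b e0 x0; rewrite pE -EFinM lee_fin.
have H1 e : 0 < e -> p * invgamma_mass m <= invgamma_cum m (2 * s ^+ 2 * (b + e)).
  move=> e0; rewrite mulrC.
  have C : invgamma_cum m x * p @[x --> +oo] --> invgamma_mass m * p.
    by apply: cvgM; [exact: cvg_invgamma_cum|exact: cvg_cst].
  apply: (cvgr_to_le C); apply: filterS (nbhs_pinfty_gt (num_real 0)) => x.
  exact: H.
have C : invgamma_cum m (2 * s ^+ 2 * (b + e)) @[e --> 0^'+] --> invgamma_cum m (2 * s ^+ 2 * b).
  apply: cvg_at_right_filter.
  rewrite -[in X in _ --> X](addr0 b).
  apply: (cvg_comp _ (invgamma_cum m)); last exact: continuous_invgamma_cum.
  by apply: cvgM; [exact: cvg_cst|apply: cvgD; [exact: cvg_cst|exact: cvg_id]].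
apply: (cvgr_to_ge C); apply: filterS (nbhs_right_gt 0) => e.
exact: H1.
Qed.

End law_of_total_integral.

(** * The density of the radius *)

Section profile.
Variables (R : realType) (c m : R).
Hypotheses (c0 : 0 < c) (m0 : 0 < m).
Notation mu := (@lebesgue_measure R).

(** The density proportional to $v^{2m-1}e^{-cv^2}$, the law of $(cX)^{-1/2}$ for
    an inverse gamma variable $X$. *)
Definition profile (v : R) : R :=
  2 / (c * invgamma_mass m) *
  expR ((m + 1) * ln c + (2 * m - 1) * ln v - c * v ^+ 2).

Definition profile_tail (v : R) : R := invgamma_cum m (c * v ^+ 2)^-1 / invgamma_mass m.

Let M0 : 0 < invgamma_mass m. Proof. exact: invgamma_mass_gt0. Qed.

Lemma profile_gt0 v : 0 < profile v.
Proof. by rewrite mulr_gt0 ?expR_gt0// divr_gt0// mulr_gt0. Qed.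

Lemma is_derive_profile_tail (v : R) : 0 < v -> is_derive v 1 profile_tail (- profile v).
Proof.
move=> v0.
have v2 : 0 < c * v ^+ 2 by rewrite mulr_gt0// exprn_gt0.
have H1 : is_derive v (1:R) (fun v : R => c * v ^+ 2) (2 * c * v).
  by apply: is_derive_eq; rewrite /GRing.scale/= ?mulr0 ?addr0 ?mulr1 ?expr1; ring.
have H2 : is_derive v (1:R) (fun v : R => (c * v ^+ 2)^-1) (- (c * v ^+ 2) ^- 2 *: (2 * c * v)).
  by apply: (@is_deriveV _ (fun v : R => c * v ^+ 2)); rewrite ?gt_eqF.
have H3 := @is_derive1_comp R (invgamma_cum m) (fun v => (c * v ^+ 2)^-1) v _ _
  (is_derive_invgamma_cum ((c * v ^+ 2)^-1) m0) H2.
rewrite /profile_tail; apply: is_derive_eq; rewrite /GRing.scale/= ?mulr0 ?addr0 ?add0r.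
rewrite /profile /invgamma_fun invr_gt0 v2 invrK lnV ?posrE// lnM ?posrE ?exprn_gt0// lnXn//.
have -> : - (m + 1) * - (ln c + ln v *+ 2) - c * v ^+ 2 =
  ((m + 1) * ln c + (2 * m - 1) * ln v - c * v ^+ 2) + 3%:R * ln v by rewrite -mulr_natl; ring.
rewrite expRD expRM_natl lnK ?posrE//; field.
by rewrite !gt_eqF.
Qed.

Lemma continuous_profile (v : R) : 0 < v -> {for v, continuous profile}.
Proof.
move=> v0; apply: cvgM; first exact: cvg_cst.
apply: (cvg_comp _ expR); last exact: continuous_expR.
apply: cvgB.
  apply: cvgD; first exact: cvg_cst.
  by apply: cvgM; [exact: cvg_cst|exact: continuous_ln].
by apply: cvgM; [exact: cvg_cst|exact: exprn_continuous].
Qed.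

Lemma measurable_profile : measurable_fun [set: R] profile.
Proof.
apply: measurable_funM => //; apply: measurableT_comp => //.
apply: measurable_funB.
  apply: measurable_funD => //; apply: measurable_funM => //; exact: measurable_ln.
by apply: measurable_funM => //; exact: exprn_measurable.
Qed.

Lemma profile_tail_cvgy : profile_tail v @[v --> +oo] --> 0.
Proof.
have : (c * v ^+ 2)^-1 @[v --> +oo] --> (0 : R).
  apply/gtr0_cvgV0.
    near=> v; rewrite mulr_gt0// exprn_gt0//; near: v; exact: nbhs_pinfty_gt.
  apply/gt0_cvgMry => //; exact: cvgr_expr2.
move=> H; rewrite -(mul0r (invgamma_mass m)^-1) -(invgamma_cum_neg m (lexx 0)).
apply: cvgM; last exact: cvg_cst.
apply: (cvg_comp _ (invgamma_cum m)); first exact: H.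
exact: continuous_invgamma_cum.
Unshelve. all: by end_near. Qed.

Lemma integral_profile (a : R) : 0 < a ->
  (\int[mu]_(r in `[a, +oo[) (profile r)%:E = (profile_tail a)%:E)%E.
Proof.
move=> a0.
have D v : a <= v -> is_derive v 1 (- profile_tail) (profile v).
  move=> av; have H := is_derive_profile_tail (lt_le_trans a0 av).
  by apply: is_derive_eq; rewrite opprK.
rewrite (@ge0_continuous_FTC2y _ profile (- profile_tail) a 0).
- by rewrite -EFinB sub0r opprK.
- by move=> x _; exact/ltW/profile_gt0.
- apply: continuous_in_subspaceT => x; rewrite inE/= in_itv/= andbT => ax.
  exact/continuous_profile/(lt_le_trans a0).
- by rewrite -oppr0; apply: cvgN; exact: profile_tail_cvgy.
- by move=> x ax; have [] := D x (ltW ax).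
- apply: cvg_at_right_filter.
  by apply/differentiable_continuous/derivable1_diffP; have [] := D a (lexx a).
- move=> x; rewrite in_itv/= andbT => ax; rewrite derive1E.
  by have [_ ->] := D x (ltW ax).
Qed.

(** The density may have a pole at the origin, so the mass is exhausted by the
    half-lines from $1/(n+1)$. *)
Lemma integral_profile_pos : (\int[mu]_(r in `]0%R, +oo[) (profile r)%:E = 1)%E.
Proof.
pose F (n : nat) : set R := [set` `[n.+1%:R^-1, +oo[].
have UF : \bigcup_n F n = [set` `]0, +oo[].
  apply/seteqP; split => x /=.
    move=> [n _]; rewrite /F/= !in_itv/= !andbT; apply: lt_le_trans.
    by rewrite invr_gt0.
  rewrite in_itv/= andbT => x0.
  have [n nx] : exists n : nat, x^-1 <= n.+1%:R.
    exists (Num.bound x^-1); apply/ltW/(lt_le_trans (archi_boundP _)).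
      by rewrite invr_ge0 ltW.
    by rewrite ler_nat.
  exists n => //; rewrite /F/= in_itv/= andbT.
  by rewrite invf_ple ?posrE.
have H1 : (\int[mu]_(r in F n) (profile r)%:E)%E @[n --> \oo] -->
   (\int[mu]_(r in \bigcup_n F n) (profile r)%:E)%E.
  apply: ge0_nondecreasing_set_cvg_integral.
  - move=> n k nk; apply/subsetPset => x; rewrite /F/= !in_itv/= !andbT.
    by apply: le_trans; rewrite lef_pV2 ?posrE// ler_nat.
  - by move=> n; exact: measurable_itv.
  - by move=> n; apply/measurable_EFinP; apply: measurable_funTS; exact: measurable_profile.
  - by move=> n x _; rewrite lee_fin ltW// profile_gt0.
rewrite -UF -(cvg_lim _ H1)//; apply/cvg_lim => //.
under eq_fun do rewrite /F integral_profile ?invr_gt0//.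
apply: cvg_EFin; first exact: nearW.
have : invgamma_cum m x / invgamma_mass m @[x --> +oo] --> (1 : R).
  rewrite -(@divff _ (invgamma_mass m)) ?gt_eqF//.
  by apply: cvgM; [exact: cvg_invgamma_cum|exact: cvg_cst].
move=> H.
apply: (cvg_comp (fun n : nat => (c * (n.+1%:R^-1) ^+ 2)^-1) _ _ H).
under eq_fun do rewrite exprVn invfM invrK.
have S : (n.+1%:R : R) @[n --> \oo] --> +oo.
  by have := @cvgr_idn R; rewrite -(cvg_shiftS (fun n => n%:R : R)).
apply: (cvg_comp _ (fun x : R => c^-1 * x ^+ 2) S).
by apply: gt0_cvgMry; [rewrite invr_gt0|exact: cvgr_expr2].
Qed.

End profile.

(** * The law of the random radius *)

Lemma ae_eq_probability (R : realType) (d : measure_display) (T : measurableType d)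
    (P : probability T R) (A B : set T) : measurable A -> measurable B ->
  {ae P, forall w, A w <-> B w} -> P A = P B.
Proof.
move=> mA mB AB.
have E (D : set T) : measurable D -> P D = (\int[P]_w (\1_D w)%:E)%E.
  by move=> mD; rewrite integral_indic// setIT.
rewrite !E//; apply: ae_eq_integral => //; try exact/measurable_EFinP/measurable_indic.
apply: filterS AB => w ABw _; rewrite !indicE; congr ((_ : bool)%:R%:E).
by apply/idP/idP; rewrite !inE => /ABw.
Qed.

Section law_of_radius.
Context (R : realType) (d : measure_display) (Omega : measurableType d).
Variables (P : probability Omega R) (W : R -> Omega -> R).
Hypothesis hW : two_sided_brownian_motion P W.
Variables (alpha sigma N : R).
Hypotheses (alpha0 : 0 < alpha) (sigma_bound : 0 < sigma ^+ 2 < 2 * alpha) (N0 : 0 < N).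
Notation mu := (@lebesgue_measure R).

Let m := alpha / sigma ^+ 2 - 2^-1.
Let c := alpha / (sigma ^+ 2 * N ^+ 2).

Let s20 : 0 < sigma ^+ 2. Proof. by case/andP: sigma_bound. Qed.

Let s0 : sigma != 0.
Proof. by apply: contraTneq s20 => ->; rewrite expr0n ltxx. Qed.

Let m0 : 0 < m.
Proof.
rewrite /m subr_gt0 ltr_pdivlMr// mulrC ltr_pdivrMr// mulrC.
by case/andP: sigma_bound.
Qed.

Let c0 : 0 < c. Proof. by rewrite divr_gt0// mulr_gt0// exprn_gt0. Qed.

Let ms : m * sigma ^+ 2 = alpha - 2^-1 * sigma ^+ 2.
Proof. by rewrite /m mulrBl divfK// gt_eqF. Qed.

Notation J := (gbm_total W m sigma).

Definition ug_integral (w : Omega) : \bar R := (\int[mu]_(x in `]-oo, 0%R])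
   (expR (2 * ((alpha - 2^-1 * sigma ^+ 2) * x + sigma * W x w)))%:E)%E.

(** Time reversal, together with a factor that is $1$ almost surely; keeping it
    gives an identity for every path, which makes [u_g] measurable although
    the probability space need not be complete. *)
Lemma ug_integralE w : ug_integral w = ((expR (2 * (sigma * W 0 w)))%:E * J w)%E.
Proof.
have [mW _ cW _ _] := hW.
rewrite /ug_integral -[in X in `]-oo, X]]oppr0 ge0_integration_by_substitutionNy; last 2 first.
- apply: continuous_subspaceT => x.
  apply: (cvg_comp _ expR); last exact: continuous_expR.
  apply: cvgM; first exact: cvg_cst.
  by apply: cvgD; apply: cvgM; [exact: cvg_cst|exact: cvg_id|exact: cvg_cst|exact: cW].
- by move=> x _; exact: expR_ge0.
rewrite /gbm_total -ge0_integralZl//; last 2 first.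
- apply/measurable_EFinP; apply: measurable_funTS.
  by apply: continuous_measurable_fun; exact: (@continuous_backward_gbm _ _ _ _ _ hW m sigma w).
- by move=> u _; rewrite lee_fin expR_ge0.
apply: eq_integral => u _; rewrite -EFinM; congr EFin.
rewrite /= /backward_gbm -expRD; congr expR; rewrite ms; ring.
Qed.

Lemma measurable_gbm_total : measurable_fun [set: Omega] J.
Proof.
apply: (emeasurable_fun_cvg (fun n w => (gbm_integral W m sigma n.+1%:R w)%:E)).
  by move=> n; apply/measurable_EFinP; exact: (measurable_gbm_integral hW).
move=> w _; have := @gbm_integral_cvg _ _ _ _ _ hW m sigma w.
by rewrite -(cvg_shiftS (fun n => (gbm_integral W m sigma n%:R w)%:E)).
Qed.

Lemma measurable_u_g : measurable_fun [set: Omega] (u_g W alpha sigma).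
Proof.
rewrite (_ : u_g W alpha sigma = fun w => (2 * alpha * fine ((expR (2 * (sigma * W 0 w)))%:E * J w)%E) `^ (- 2^-1)); last first.
  by apply/funext => w; rewrite /u_g -/(ug_integral w) ug_integralE.
have [mW _ _ _ _] := hW.
apply: (measurableT_comp (measurable_powR (- 2^-1))).
apply: measurable_funM => //; apply: (measurableT_comp (fine_measurable measurableT)).
apply: emeasurable_funM; last exact: measurable_gbm_total.
apply/measurable_EFinP; apply: measurableT_comp => //; apply: measurable_funM => //.
by apply: measurable_funM.
Qed.

Lemma gbm_total_ge0 w : (0 <= J w)%E.
Proof. by apply: integral_ge0 => u _; rewrite lee_fin expR_ge0. Qed.

(** The condition [~ (j <= 0)] also covers infinite [j] through the first
    condition: by convention [u_g] vanishes in both degenerate cases. *)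
Lemma powR_half_ge (j : \bar R) (l : R) : 0 < l -> (0 <= j)%E ->
  (l <= (2 * alpha * fine j) `^ (- 2^-1)) <->
  ((j <= (2 * alpha * l ^+ 2)^-1%:E)%E /\ ~ (j <= 0)%E).
Proof.
move=> l0; have l2 : 0 < 2 * alpha * l ^+ 2 by rewrite !mulr_gt0.
have P0 : (0 : R) `^ (- 2^-1) = 0 by rewrite powR0// oppr_eq0 invr_eq0.
case: j => [r||] //= r0; last first.
  rewrite mulr0 P0; split; first by rewrite leNgt l0.
  by case; rewrite leye_eq.
move: r0; rewrite !lee_fin => r0; have [->|rn0] := eqVneq r 0.
  by rewrite mulr0 P0; split; [rewrite leNgt l0|case; rewrite lexx].
have r1 : 0 < r by rewrite lt_neqAle eq_sym rn0.
have ar : 0 < 2 * alpha * r by rewrite !mulr_gt0.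
rewrite powRN (powR12_sqrt (ltW ar)).
have -> : (l <= (Num.sqrt (2 * alpha * r))^-1) = (r <= (2 * alpha * l ^+ 2)^-1).
  rewrite -[l in LHS]invrK lef_pV2 ?posrE ?invr_gt0 ?sqrtr_gt0//.
  have li : 0 <= l^-1 by rewrite invr_ge0 ltW.
  rewrite -[l^-1](ger0_norm li) -sqrtr_sqr ler_psqrt ?nnegrE ?(ltW ar) ?sqr_ge0//.
  by rewrite invfM -ler_pdivlMl ?mulr_gt0// exprVn.
split=> [H|[H _]] //; split => //.
by apply/negP; rewrite -ltNge.
Qed.

Lemma prob_u_g_ge (l : R) : 0 < l ->
  P [set w | l <= u_g W alpha sigma w] =
  (invgamma_cum m (sigma ^+ 2 / (alpha * l ^+ 2)) / invgamma_mass m)%:E.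
Proof.
move=> l0.
pose b := (2 * alpha * l ^+ 2)^-1.
have mJ x := measurable_gbm_total_le hW m sigma x.
have mA : measurable [set w | l <= u_g W alpha sigma w].
  rewrite (_ : [set _ | _] = u_g W alpha sigma @^-1` [set` `[l, +oo[]).
    by rewrite -[X in measurable X]setTI; exact: measurable_u_g.
  by apply/seteqP; split => w /=; rewrite in_itv/= andbT.
have mB : measurable ([set w | (J w <= b%:E)%E] `\` [set w | (J w <= 0%:E)%E]).
  exact: measurableD.
have -> : P [set w | l <= u_g W alpha sigma w] =
   P ([set w | (J w <= b%:E)%E] `\` [set w | (J w <= 0%:E)%E]).
  apply: ae_eq_probability => //.
  have [_ W0 _ _ _] := hW; apply: filterS W0 => w W0w /=.
  have -> : u_g W alpha sigma w = (2 * alpha * fine (J w)) `^ (- 2^-1).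
    by rewrite /u_g -/(ug_integral w) ug_integralE W0w !mulr0 expR0 mul1e.
  exact: (powR_half_ge l0 (gbm_total_ge0 w)).
have s2 := gbm_total_law hW m0 s0.
have fP (A : set Omega) : measurable A -> (P A < +oo)%E.
  by move=> mD; rewrite (le_lt_trans (probability_le1 P mD)) ?ltry.
rewrite measureD//; last exact: fP.
rewrite setIidr; last first.
  move=> w /= H; apply: (le_trans H); rewrite lee_fin invr_ge0.
  by rewrite !mulr_ge0 ?sqr_ge0// ltW.
apply: (eq_trans (congr2 (fun x y => x - y)%E (s2 b) (s2 0))).
rewrite mulr0 (invgamma_cum_neg _ (lexx 0)) mul0r sube0.
congr ((invgamma_cum _ _ / _)%:E); rewrite /b; field.
by rewrite !gt_eqF.
Qed.

Lemma prob_radius_ge (a : R) : 0 < a ->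
  P [set w | a <= N * u_g W alpha sigma w] = (profile_tail c m a)%:E.
Proof.
move=> a0.
have -> : [set w | a <= N * u_g W alpha sigma w] = [set w | a / N <= u_g W alpha sigma w].
  by apply/seteqP; split => w /=; rewrite ler_pdivrMr// mulrC.
rewrite prob_u_g_ge ?divr_gt0//; congr ((invgamma_cum _ _ / _)%:E).
by rewrite /c; field; rewrite s0 !gt_eqF.
Qed.

End law_of_radius.

Section positive_density.
Context (R : realType) (f : R -> R).
Hypotheses (f0 : forall x, 0 <= f x) (mf : measurable_fun [set: R] f).
Notation mu := (@lebesgue_measure R).

Definition positive_density (B : set (measurableTypeR R)) : \bar R :=
  (\int[mu]_(r in [set r : R | 0 < r /\ B r]%R) (f r)%:E)%E.

Let posE (B : set R) : [set r : R | 0 < r /\ B r] = [set` `]0, +oo[] `&` B.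
Proof. by apply/seteqP; split => r /=; rewrite in_itv/= andbT. Qed.

Let positive_density0 : positive_density set0 = 0%E.
Proof. by rewrite /positive_density posE setI0 integral_set0. Qed.

Let positive_density_ge0 B : (0 <= positive_density B)%E.
Proof. by apply: integral_ge0 => x _; rewrite lee_fin. Qed.

Let positive_density_sigma_additive : semi_sigma_additive positive_density.
Proof.
move=> /= F mF tF mUF; rewrite /positive_density.
under [X in X @ _ --> _]eq_fun do under eq_bigr do rewrite posE.
rewrite posE setI_bigcupr ge0_integral_bigcup//=.
- by apply: is_cvg_ereal_nneg_natsum_cond => n _ _; apply: integral_ge0 => x _; rewrite lee_fin.
- by move=> n; apply: measurableI => //; exact: measurable_itv.
- by apply/measurable_EFinP; apply: measurable_funTS.
- by move=> x _; rewrite lee_fin.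
- exact: trivIset_setIl.
Qed.

HB.instance Definition _ := isMeasure.Build _ _ _ positive_density
  positive_density0 positive_density_ge0 positive_density_sigma_additive.

End positive_density.

Section law_on_ray.
Context (R : realType) (d : measure_display) (Omega : measurableType d).
Variables (P : probability Omega R) (V : Omega -> R).
Variables (c m : R).
Hypotheses (c0 : 0 < c) (m0 : 0 < m).
Hypotheses (mV : measurable_fun [set: Omega] V) (V0 : forall w, 0 <= V w).
Hypothesis tailV : forall a, 0 < a -> P [set w | a <= V w] = (profile_tail c m a)%:E.

(** Closed half-lines form a pi-system generating the Borel sets. *)
Lemma law_from_tail (B : set R) : measurable B ->
  P (V @^-1` B) = positive_density (profile c m) B.
Proof.
have p0 x : 0 <= profile c m x by exact/ltW/profile_gt0.
have mp := measurable_profile c m.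
have mV' : measurable_fun [set: Omega] (V : Omega -> measurableTypeR R) by exact: mV.
pose V' : {mfun Omega >-> measurableTypeR R} := 
  @mfun_Sub _ _ Omega (measurableTypeR R) V (mem_set mV').
pose m2 : {measure set (measurableTypeR R) -> \bar R} := positive_density (profile c m).
have neg a : a <= 0 -> m2 p0 mp [set` `[a, +oo[] = 1%E.
  move=> a0; rewrite /m2/= /positive_density -(integral_profile_pos c0 m0).
  congr (integral _ _ _); apply/seteqP; split => r /=; rewrite !in_itv/= !andbT; first by case.
  by move=> r0; split => //; rewrite (le_trans a0)// ltW.
have pos a : 0 < a -> m2 p0 mp [set` `[a, +oo[] = (profile_tail c m a)%:E.
  move=> a0; rewrite /m2/= /positive_density -(integral_profile c0 m0 a0).
  congr (integral _ _ _); apply/seteqP; split => r /=; rewrite !in_itv/= !andbT; first by case.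
  by move=> ar; split => //; rewrite (lt_le_trans a0).
move=> mB.
apply: (@measure_unique _ R (measurableTypeR R) (@RGenCInfty.G R) (fun n => [set` `[- n%:R, +oo[])
  _ _ _ _ (distribution P V') (m2 p0 mp)) => //.
- exact: RGenCInfty.measurableE.
- move=> _ _ [a ->] [b ->]; exists (Num.max a b).
  by apply/seteqP; split => r /=; rewrite !in_itv/= !andbT ge_max => /andP.
- by move=> n; exists (- n%:R).
- apply/seteqP; split => // r _; exists (Num.bound `|r|) => //=.
  rewrite in_itv/= andbT lerNl (le_trans (ler_norm _))// normrN.
  by apply/ltW/archi_boundP.
- move=> _ [a ->]; have [a0|a0] := leP a 0.
    rewrite neg// -(probability_setT P) /distribution/= /pushforward; congr (P _).
    by apply/seteqP; split => w //= _; rewrite in_itv/= andbT (le_trans a0).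
  rewrite pos// -tailV// /distribution/= /pushforward; congr (P _).
  by apply/seteqP; split => w /=; rewrite in_itv/= andbT.
- by move=> n; rewrite (le_lt_trans (probability_le1 _ _)) ?ltry//; exact: measurable_itv.
Qed.

End law_on_ray.

(** * Existence and uniqueness of the density along the ray *)

Section density_uniqueness.
Variable R : realType.
Notation mu := (@lebesgue_measure R).

(** Two continuous densities of the same measure are derivatives of the same
    distribution function. *)
Lemma continuous_density_unique (e1 e2 : R -> R) :
  (forall r : R, 0 < r -> {for r, continuous e1}) ->
  (forall r : R, 0 < r -> {for r, continuous e2}) ->
  (forall B : set R, measurable B ->
    (\int[mu]_(r in [set r : R | 0 < r /\ B r]%R) (e1 r)%:E =
     \int[mu]_(r in [set r : R | 0 < r /\ B r]%R) (e2 r)%:E)%E) ->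
  forall r, 0 < r -> e1 r = e2 r.
Proof.
move=> c1 c2 H r r0.
pose a := r / 2.
have a0 : 0 < a by rewrite divr_gt0.
have ar : a < r by rewrite /a; lra.
have r1 : r < r + 1 by rewrite ltrDl.
have int (e : R -> R) : (forall r : R, 0 < r -> {for r, continuous e}) ->
    mu.-integrable [set` `[a, r + 1]] (EFin \o e).
  move=> ce; apply: continuous_compact_integrable; first exact: segment_compact.
  apply: continuous_in_subspaceT => x; rewrite inE/= in_itv/= => /andP[ax _].
  exact/ce/(lt_le_trans a0).
pose F (e : R -> R) (x : R) := \int[mu]_(t in [set` `[a, x]]) e t.
have FE : F e1 = F e2.
  apply/funext => x; rewrite /F /Rintegral; congr fine.
  have -> : [set` `[a, x]] = [set r : R | 0 < r /\ [set` `[a, x]] r].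
    apply/seteqP; split => y /=; last by case.
    by move=> yx; split => //; move: yx; rewrite in_itv/= => /andP[/(lt_le_trans a0)].
  by apply: H; exact: measurable_itv.
have D e : (forall r : R, 0 < r -> {for r, continuous e}) -> (F e)^`()%classic r = e r.
  by move=> ce; have [] := continuous_FTC1_closed r1 (int e ce) ar (ce r r0).
by apply: (eq_trans (esym (D e1 c1))); rewrite FE; exact: D.
Qed.

Lemma continuous_scale_arg (g : R -> R) (k l : R) : {for l * k, continuous g} ->
  {for l, continuous (fun x : R => g (x * k))}.
Proof.
move=> cg; apply: (@continuous_comp _ _ _ (fun x : R => x * k) g) => //.
by apply: cvgM; [exact: cvg_id|exact: cvg_cst].
Qed.

End density_uniqueness.

Section ray_density_theory.
Context (R : realType) (d : measure_display) (Omega : measurableType d).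
Variables (P : probability Omega R) (W : R -> Omega -> R).
Hypothesis hW : two_sided_brownian_motion P W.
Variables (alpha : R) (Q : R * R * R).
Hypotheses (alpha0 : 0 < alpha) (Q0 : Q <> origin R).
Notation mu := (@lebesgue_measure R).
Notation N := (euclid_norm Q).

Lemma euclid_norm_gt0 : 0 < N.
Proof.
rewrite /euclid_norm sqrtr_gt0 lt_neqAle eq_sym.
rewrite !addr_ge0 ?sqr_ge0// andbT.
apply/eqP => H; apply: Q0.
have [h1 h2 h3] : [/\ Q.1.1 ^+ 2 = 0, Q.1.2 ^+ 2 = 0 & Q.2 ^+ 2 = 0].
  have := sqr_ge0 Q.1.1; have := sqr_ge0 Q.1.2; have := sqr_ge0 Q.2.
  by move=> *; split; lra.
case: Q h1 h2 h3 => -[q1 q2] q3 /= /eqP + /eqP + /eqP.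
by rewrite !sqrf_eq0 => /eqP-> /eqP-> /eqP->.
Qed.

Lemma euclid_norm_dilate (l : R) (x : R * R * R) : 0 <= l ->
  euclid_norm (dilate l x) = l * euclid_norm x.
Proof.
move=> l0; rewrite /euclid_norm /dilate/= !exprMn -!mulrDr sqrtrM ?sqr_ge0//.
by rewrite sqrtr_sqr ger0_norm.
Qed.

Lemma measurable_euclid_norm : measurable_fun [set: R * R * R] (@euclid_norm R).
Proof.
apply: measurableT_comp; first by apply: continuous_measurable_fun; exact: sqrt_continuous.
apply: measurable_funD; first apply: measurable_funD; apply: measurable_funX.
- by apply: (measurableT_comp measurable_fst); exact: measurable_fst.
- by apply: (measurableT_comp measurable_snd); exact: measurable_fst.
- exact: measurable_snd.
Qed.

Lemma measurable_dilate (g : R -> R) : measurable_fun [set: R] g ->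
  measurable_fun [set: R] (fun r => dilate (g r) Q).
Proof.
move=> mg; apply: measurable_fun_pair; first apply: measurable_fun_pair;
  by apply: measurable_funM.
Qed.

(** The point [dilate l Q] lies at distance [l * N] from the origin, and [profile]
    with these parameters is the density of the length of $u_gQ$. *)
Definition ray_profile (sigma l : R) : R :=
  profile (alpha / (sigma ^+ 2 * N ^+ 2)) (alpha / sigma ^+ 2 - 2^-1) (l * N).

Definition ray_pdf (sigma : R) (x : R * R * R) : R :=
  if `[< open_ray Q x >] then
    profile (alpha / (sigma ^+ 2 * N ^+ 2)) (alpha / sigma ^+ 2 - 2^-1) (euclid_norm x)
  else 0.

Lemma ray_pdfE sigma l : 0 < l -> ray_pdf sigma (dilate l Q) = ray_profile sigma l.
Proof.
move=> l0; rewrite /ray_pdf asboolT; last by exists l.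
by rewrite euclid_norm_dilate// ltW.
Qed.

Lemma parameters_gt0 sigma : 0 < sigma ^+ 2 < 2 * alpha ->
  0 < alpha / (sigma ^+ 2 * N ^+ 2) /\ 0 < alpha / sigma ^+ 2 - 2^-1.
Proof.
move=> /andP[s0 s2]; have N0 := euclid_norm_gt0; split.
  by rewrite divr_gt0// mulr_gt0// exprn_gt0.
by rewrite subr_gt0 ltr_pdivlMr// mulrC ltr_pdivrMr// mulrC.
Qed.

Lemma ray_density_exists : density_family P W alpha Q ray_pdf.
Proof.
move=> sigma sb; have N0 := euclid_norm_gt0.
have [c0 m0] := parameters_gt0 sb; split.
- by move=> x; rewrite /ray_pdf; case: ifPn => // _; exact/ltW/profile_gt0.
- by move=> x xQ; rewrite /ray_pdf asboolF.
- move=> l l0.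
  have C : {for l, continuous (ray_profile sigma)}.
    exact: (continuous_scale_arg (continuous_profile (mulr_gt0 l0 N0))).
  rewrite /prop_for /continuous_at ray_pdfE//.
  apply: cvg_trans C; apply: near_eq_cvg; near=> k; rewrite ray_pdfE//.
  by near: k; exact: lt_nbhsr.
move=> A mA.
pose B := (fun r => dilate (r / N) Q) @^-1` A.
have mB : measurable B.
  by rewrite -[B]setTI; apply: measurable_dilate => //; exact: measurable_funM.
pose V w := N * u_g W alpha sigma w.
have mV : measurable_fun [set: Omega] V.
  by apply: measurable_funM => //; exact: (measurable_u_g hW).
have -> : mu_Q P W alpha Q sigma A = P (V @^-1` B).
  rewrite /mu_Q /pushforward; congr (P _); apply/seteqP; split => w;
  by rewrite /= /B/= /V mulrAC divff ?gt_eqF// mul1r.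
have V0 w : 0 <= V w by rewrite mulr_ge0 ?powR_ge0// ltW.
rewrite (law_from_tail c0 m0 mV V0 _ mB); last first.
  by move=> a a0; exact: (prob_radius_ge hW).
apply: eq_integral => r; rewrite inE/= => -[r0 _].
by rewrite ray_pdfE ?divr_gt0// /ray_profile divfK// gt_eqF.
Unshelve. all: by end_near. Qed.

(** The preimages of Borel sets under the Euclidean norm see every Borel set of
    radii, so the density of the radius is determined, and it is continuous. *)
Lemma ray_density_unique f sigma l : density_family P W alpha Q f ->
  0 < sigma ^+ 2 < 2 * alpha -> 0 < l -> f sigma (dilate l Q) = ray_profile sigma l.
Proof.
move=> fd sb l0; have N0 := euclid_norm_gt0.
have [_ _ fc fi] := fd sigma sb.
have [_ _ gc gi] := ray_density_exists sb.
rewrite -ray_pdfE//.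
have -> : l = l * N / N by rewrite mulfK// gt_eqF.
apply: (@continuous_density_unique R (fun r => f sigma (dilate (r / N) Q))
  (fun r => ray_pdf sigma (dilate (r / N) Q))); last exact: mulr_gt0.
- by move=> r r0; exact: (continuous_scale_arg (fc _ (divr_gt0 r0 N0))).
- by move=> r r0; exact: (continuous_scale_arg (gc _ (divr_gt0 r0 N0))).
move=> B mB.
have mA : measurable (@euclid_norm R @^-1` B).
  by rewrite -[X in measurable X]setTI; exact: measurable_euclid_norm.
have E : [set r : R | 0 < r /\ (@euclid_norm R @^-1` B) (dilate (r / N) Q)] =
    [set r : R | 0 < r /\ B r].
  apply/seteqP; split => r /= [r0]; rewrite euclid_norm_dilate ?divr_ge0 ?(ltW r0) ?(ltW N0)//;
  by rewrite divfK ?gt_eqF.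
by have := fi _ mA; rewrite (gi _ mA) E.
Qed.

End ray_density_theory.

(** * The bifurcation *)

Section shape.
Variables (R : realType) (c m : R).
Hypotheses (c0 : 0 < c) (m0 : 0 < m).
Notation density := (profile c m).

Let M0 : 0 < invgamma_mass m. Proof. exact: invgamma_mass_gt0. Qed.

Let K0 : 0 < 2 / (c * invgamma_mass m). Proof. by rewrite divr_gt0// mulr_gt0. Qed.

Lemma profile_lt x y :
  ((2 * m - 1) * ln x - c * x ^+ 2 < (2 * m - 1) * ln y - c * y ^+ 2) = (density x < density y).
Proof. by rewrite /profile ltr_pM2l// ltr_expR -!addrA ltrD2l. Qed.

(** Strict concavity of the logarithm, from $1+z<e^z$ for $z=\pm\ln(y/x)$. *)
Lemma ln_diff_bounds (x y : R) : 0 < x -> x < y ->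
  (y - x) / y < ln y - ln x < (y - x) / x.
Proof.
move=> x0 xy; have y0 := lt_trans x0 xy.
have z0 : ln y - ln x != 0 by rewrite gt_eqF// subr_gt0 ltr_ln.
apply/andP; split.
- have := expR_gt1Dx (x := - (ln y - ln x)); rewrite oppr_eq0 => /(_ z0).
  rewrite opprB expRB !lnK ?posrE// => H.
  have -> : (y - x) / y = 1 - x / y by rewrite mulrBl divff// gt_eqF.
  by move: H; lra.
- have := expR_gt1Dx z0; rewrite expRB !lnK ?posrE// => H.
  have -> : (y - x) / x = y / x - 1 by rewrite mulrBl divff// gt_eqF.
  by move: H; lra.
Qed.

Let ln_sqr (x : R) : 0 < x -> ln (x ^+ 2) = 2 * ln x.
Proof. by move=> x0; rewrite lnXn// mulr_natl. Qed.

(** Comparing $\ln y^2-\ln x^2$ with $y^2-x^2$: the exponent increases as long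
    as its derivative $(2m-1)/v-2cv$ is nonnegative. *)
Lemma profile_increasing x y : 0 < x -> x < y -> 2 * c * y ^+ 2 <= 2 * m - 1 ->
  density x < density y.
Proof.
move=> x0 xy H; have y0 := lt_trans x0 xy; rewrite -profile_lt.
have x2 : 0 < x ^+ 2 by rewrite exprn_gt0.
have y2 : 0 < y ^+ 2 by rewrite exprn_gt0.
have xy2 : x ^+ 2 < y ^+ 2 by rewrite ltr_sqr ?nnegrE// ltW.
have /andP[+ _] := ln_diff_bounds x2 xy2; rewrite !ln_sqr// => L.
have b0 : 0 < 2 * m - 1 by apply: lt_le_trans H; rewrite !mulr_gt0.
have := ltr_pM2l b0 ((y ^+ 2 - x ^+ 2) / y ^+ 2) (2 * ln y - 2 * ln x).
rewrite L => H1.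
have H2 : 2 * c * (y ^+ 2 - x ^+ 2) <= (2 * m - 1) * ((y ^+ 2 - x ^+ 2) / y ^+ 2).
  rewrite mulrA ler_pdivlMr// mulrAC ler_wpM2r// subr_ge0 ltW//.
lra.
Qed.

Lemma profile_decreasing x y : 0 < x -> x < y -> 2 * m - 1 <= 2 * c * x ^+ 2 ->
  density y < density x.
Proof.
move=> x0 xy H; have y0 := lt_trans x0 xy; rewrite -profile_lt.
have x2 : 0 < x ^+ 2 by rewrite exprn_gt0.
have xy2 : x ^+ 2 < y ^+ 2 by rewrite ltr_sqr ?nnegrE// ltW.
have /andP[_ +] := ln_diff_bounds x2 xy2; rewrite !ln_sqr// => L.
have cxy : 0 < c * (y ^+ 2 - x ^+ 2) by rewrite mulr_gt0// subr_gt0.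
have [b0|b0] := leP (2 * m - 1) 0.
  have : (2 * m - 1) * (ln y - ln x) <= 0.
    by rewrite mulr_le0_ge0// subr_ge0 ltW// ltr_ln.
  lra.
have := ltr_pM2l b0 (2 * ln y - 2 * ln x) ((y ^+ 2 - x ^+ 2) / x ^+ 2).
rewrite L => H1.
have H2 : (2 * m - 1) * ((y ^+ 2 - x ^+ 2) / x ^+ 2) <= 2 * c * (y ^+ 2 - x ^+ 2).
  by rewrite mulrA ler_pdivrMr// [leRHS]mulrAC ler_wpM2r// subr_ge0 ltW.
lra.
Qed.

Let K1 := 2 / (c * invgamma_mass m) * expR ((m + 1) * ln c).

Let profileE x : density x = K1 * (expR ((2 * m - 1) * ln x) * expR (- (c * x ^+ 2))).
Proof. by rewrite /profile /K1 -[RHS]mulrA -!expRD addrA. Qed.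

Lemma profile_cvg0 : 0 < 2 * m - 1 -> density x @[x --> 0^'+] --> 0.
Proof.
move=> b0.
have H : K1 * (x `^ (2 * m - 1)) @[x --> 0^'+] --> 0.
  rewrite -[X in _ --> X](mulr0 K1); apply: cvgM; [exact: cvg_cst|exact: powR_cvg0].
apply: squeeze_cvgr (cvg_cst 0) H.
near=> x; have x0 : 0 < x by near: x; exact: nbhs_right_gt.
rewrite (ltW (profile_gt0 _ _ _))//= profileE /powR gt_eqF//.
have K10 : 0 <= K1 by rewrite mulr_ge0 ?expR_ge0// ltW.
apply: ler_wpM2l => //; rewrite -[leRHS]mulr1; apply: ler_wpM2l; first exact: expR_ge0.
by rewrite expR_le1 oppr_le0 mulr_ge0 ?sqr_ge0// ltW.
Unshelve. all: by end_near. Qed.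

Lemma profile_cvgy : 2 * m - 1 < 0 -> density x @[x --> 0^'+] --> +oo.
Proof.
move=> b0; apply/cvgryPge => A.
have K10 : 0 < K1 by rewrite mulr_gt0 ?expR_gt0.
pose L := A / (K1 * expR (- c)).
have := @lnNy R; move/cvgrNyPle => /(_ (L / (2 * m - 1))) HL.
near=> x; have x0 : 0 < x by near: x; exact: nbhs_right_gt.
have x1 : x <= 1 by near: x; exact: nbhs_right_le.
have lx : ln x <= L / (2 * m - 1) by near: x.
have Lx : L <= (2 * m - 1) * ln x by rewrite -ler_ndivlMl// mulrC.
rewrite profileE -ler_pdivrMl//.
have e1 : expR (- c) <= expR (- (c * x ^+ 2)).
  by rewrite ler_expR lerN2 ler_piMr ?exprn_ile1 ?ltW.
apply: (@le_trans _ _ (expR ((2 * m - 1) * ln x) * expR (- c))); last first.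
  by rewrite ler_wpM2l ?expR_ge0.
rewrite -ler_pdivrMr ?expR_gt0//.
have -> : K1^-1 * A / expR (- c) = L by rewrite /L; clearbody K1; field; rewrite !gt_eqF ?expR_gt0.
by apply: (le_trans Lx); have := expR_ge1Dx ((2 * m - 1) * ln x); lra.
Unshelve. all: by end_near. Qed.

End shape.

Lemma cvg_scale_right0 (R : realType) (N : R) : 0 < N -> l * N @[l --> 0^'+] --> 0^'+.
Proof.
move=> N0 A [e /= e0 eA].
suff : \forall l \near (0 : R)^'+, A (l * N) by [].
near=> l.
have l0 : 0 < l by near: l; exact: nbhs_right_gt.
apply: eA; last by rewrite mulr_gt0.
rewrite /ball_/= sub0r normrN gtr0_norm ?mulr_gt0// -ltr_pdivlMr//.
by near: l; apply: nbhs_right_lt; rewrite divr_gt0.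
Unshelve. all: by end_near. Qed.

Unset Implicit Arguments.

Theorem theorem6p4 (R : realType) (d : measure_display)
    (Omega : measurableType d) (P : probability Omega R) (W : R -> Omega -> R)
    (hW : two_sided_brownian_motion P W)
    (alpha d1 d2 d3 : R) (halpha : 0 < alpha)
    (Q : R * R * R) (hQ_octant : octant R Q) (hQ_neq0 : Q <> origin R)
    (hQ_eq : equilibrium alpha d1 d2 d3 Q) :
  (exists f : R -> R * R * R -> R, density_family P W alpha Q f) /\
  (forall f : R -> R * R * R -> R,
     density_family P W alpha Q f -> P_bifurcation alpha Q f).
Proof.
split; first by exists (ray_pdf alpha Q); exact: ray_density_exists.
move=> f fd; have N0 := euclid_norm_gt0 hQ_neq0; set N := euclid_norm Q in N0.
have fE sigma l : 0 < sigma ^+ 2 < 2 * alpha -> 0 < l ->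
    f sigma (dilate l Q) = ray_profile alpha Q sigma l.
  by move=> sb l0; exact: (ray_density_unique hW halpha hQ_neq0 fd sb l0).
have lim0 sigma (F : set_system R) : 0 < sigma ^+ 2 < 2 * alpha ->
    ray_profile alpha Q sigma l @[l --> 0^'+] --> F -> f sigma (dilate l Q) @[l --> 0^'+] --> F.
  move=> sb; apply: cvg_trans; apply: near_eq_cvg; near=> l.
  have l0 : 0 < l by near: l; exact: nbhs_right_gt.
  by rewrite fE.
have beta sigma : 0 < sigma ^+ 2 -> 2 * (alpha / sigma ^+ 2 - 2^-1) - 1 = 2 * (alpha - sigma ^+ 2) / sigma ^+ 2.
  by move=> s0; field; rewrite -sqrf_eq0 gt_eqF.
split=> sigma /andP[s1 s2].
- have sb : 0 < sigma ^+ 2 < 2 * alpha by rewrite s1/=; lra.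
  have [c0 m0] := parameters_gt0 halpha hQ_neq0 sb.
  have b0 : 0 < 2 * (alpha / sigma ^+ 2 - 2^-1) - 1.
    by rewrite beta// divr_gt0// mulr_gt0// subr_gt0.
  split; last first.
    apply: lim0 => //; apply: (cvg_comp _ _ (cvg_scale_right0 N0)).
    exact: profile_cvg0.
  set c := alpha / (sigma ^+ 2 * N ^+ 2) in c0.
  set b := 2 * (alpha / sigma ^+ 2 - 2^-1) - 1 in b0.
  (* The derivative $b/v-2cv$ of the exponent vanishes at this radius. *)
  pose v := Num.sqrt (b / (2 * c)).
  have v0 : 0 < v by rewrite sqrtr_gt0 divr_gt0// mulr_gt0.
  have c2 : 0 < 2 * c by rewrite mulr_gt0.
  have v2 : 2 * c * v ^+ 2 = b.
    have q0 : 0 <= b / (2 * c) by rewrite divr_ge0// ltW.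
    by rewrite /v (sqr_sqrtr q0) mulrC divfK// gt_eqF.
  exists (v / N); first by rewrite divr_gt0.
  split=> x y.
    move=> x0 xy yv; have y0 := lt_trans x0 xy.
    rewrite !fE// /ray_profile; apply: profile_increasing => //; rewrite ?mulr_gt0 ?ltr_pM2r//.
    rewrite -/b -v2 -/c ler_pM2l// ler_sqr ?nnegrE ?mulr_ge0 ?(ltW y0) ?(ltW N0) ?(ltW v0)//.
    by rewrite -ler_pdivlMr.
  move=> vx xy; have x0 : 0 < x by rewrite (lt_le_trans _ vx)// divr_gt0.
  have y0 := lt_trans x0 xy.
  rewrite !fE// /ray_profile; apply: profile_decreasing => //; rewrite ?mulr_gt0 ?ltr_pM2r//.
  rewrite -/b -v2 -/c ler_pM2l// ler_sqr ?nnegrE ?mulr_ge0 ?(ltW x0) ?(ltW N0) ?(ltW v0)//.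
  by rewrite -ler_pdivrMr.
- have sb : 0 < sigma ^+ 2 < 2 * alpha by rewrite s2 (lt_trans halpha).
  have [c0 m0] := parameters_gt0 halpha hQ_neq0 sb.
  have s0 := lt_trans halpha s1.
  have b0 : 2 * (alpha / sigma ^+ 2 - 2^-1) - 1 < 0.
    by rewrite beta// pmulr_llt0 ?invr_gt0// pmulr_rlt0// subr_lt0.
  split; last first.
    apply: lim0 => //; apply: (cvg_comp _ _ (cvg_scale_right0 N0)).
    exact: profile_cvgy.
  move=> x y x0 xy; have y0 := lt_trans x0 xy.
  rewrite !fE// /ray_profile; apply: profile_decreasing => //; rewrite ?mulr_gt0 ?ltr_pM2r//.
  apply: (le_trans (ltW b0)); apply: mulr_ge0; last exact: sqr_ge0.
  by apply: mulr_ge0 => //; exact: ltW.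
Unshelve. all: by end_near. Qed.
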